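(* Let $1<s<2$ and, for $\lambda>1$, let $$W_\lambda(t)=\sum_{k=1}^{\infty}\lambda^{(s-2)k}\sin(\lambda^k t),\qquad t\in\mathbb{R}.$$ Then, provided $\lambda$ is sufficiently large, the critical order of $W_\lambda$ (the supremum of the orders up to which its local fractional derivatives exist) equals $2-s$ at every point $t\in\mathbb{R}$.
   Context: Riemann–Liouville fractional derivative: for $0<q<1$ and $x>a$, $$\frac{d^q g(x)}{[d(x-a)]^q}=\frac{1}{\Gamma(1-q)}\frac{d}{dx}\int_a^x\frac{g(u)}{(x-u)^q}\,du,$$ and for $q=1$ it is the ordinary first derivative. Local fractional derivative (LFD): for $0<q\le 1$, the LFD of order $q$ of a function $f$ at a point $y$ is $$\mathbb{D}^q f(y)=\lim_{x\to y^+}\frac{d^q\,(f(x)-f(y))}{[d(x-y)]^q},$$ where the right-hand side is the Riemann–Liouville derivative, with lower limit $a=y$ and evaluated at $x$, of the function $u\mapsto f(u)-f(y)$. The LFD is said to exist if this limit exists and is finite. (The convention that the limit is taken from the right is the paper's default.) Critical order: the critical order of $f$ at $y$ is $$\alpha(y)=\sup\{q:\ \mathbb{D}^{q'}f(y)\text{ exists for all } q'<q\}.$$ Here the orders $q,q'$ range over $(0,1]$, which is the relevant range since $W_\lambda$ is nowhere differentiable. *)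

(* Defs.v *)
From mathcomp Require Import all_boot all_order all_algebra.
From mathcomp Require Import all_classical all_reals all_analysis.

Set Implicit Arguments.
Unset Strict Implicit.
Unset Printing Implicit Defensive.

Import Order.TTheory GRing.Theory Num.Theory.
Import numFieldNormedType.Exports.

Local Open Scope classical_set_scope.
Local Open Scope ring_scope.

(* Euler's integral; only used for z > 0, where it converges. *)
Definition Gamma (R : realType) (z : R) : R :=
  \int[@lebesgue_measure R]_(u in `]0, +oo[) (u `^ (z - 1) * expR (- u)).

(* For q > 0 the kernel (x - u)^-q is read as 0 at the singular point u = x
   (0 `^ q = 0 and 0^-1 = 0), which is Lebesgue-negligible. *)
Definition RL_integrand (R : realType) (q : R) (g : R -> R) (x u : R) : R :=
  g u / (x - u) `^ q.

Definition RL_integral (R : realType) (q a : R) (g : R -> R) (x : R) : R :=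
  \int[@lebesgue_measure R]_(u in `[a, x]) RL_integrand q g x u.

(* Value at x > a of the Riemann-Liouville derivative of order 0 < q <= 1 of g
   with lower limit a.  This function is total, and is only meaningful
   together with RL_derivable. *)
Definition RL_derive (R : realType) (q a : R) (g : R -> R) (x : R) : R :=
  if q == 1 then derive1 g x
  else (Gamma (1 - q))^-1 * derive1 (RL_integral q a g) x.

(* Existence of that derivative: Rintegral and derive1 are total functions, so
   convergence of the integrals around x and differentiability at x have to be
   required separately. *)
Definition RL_derivable (R : realType) (q a : R) (g : R -> R) (x : R) : Prop :=
  if q == 1 then derivable g x 1
  else (\forall z \near x, (@lebesgue_measure R).-integrable `[a, z]
                             (EFin \o RL_integrand q g z)) /\
       derivable (RL_integral q a g) x 1.

(* l is the local fractional derivative of order q of f at y. *)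
Definition is_LFD (R : realType) (q : R) (f : R -> R) (y l : R) : Prop :=
  let g := fun u => f u - f y in
  (\forall x \near y^'+, RL_derivable q y g x) /\
  RL_derive q y g x @[x --> y^'+] --> l.

Definition LFD_exists (R : realType) (q : R) (f : R -> R) (y : R) : Prop :=
  exists l : R, is_LFD q f y l.

(* The orders q, q' range over ]0, 1] (q' <= 1 follows from q' < q <= 1).
   The set is bounded by 1; sup set0 = 0 is the supremum of the empty set of
   positive orders. *)
Definition critical_order (R : realType) (f : R -> R) (y : R) : R :=
  sup [set q : R | 0 < q <= 1 /\
         forall q' : R, 0 < q' -> q' < q -> LFD_exists q' f y].

Definition weierstrass (R : realType) (s lambda t : R) : R :=
  limn (fun n : nat => \sum_(1 <= k < n.+1)
    (lambda `^ ((s - 2) * k%:R) * sin (lambda ^+ k * t)) : R).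

(* Main.v *)
(* Write W for the function, alpha = 2 - s and I for the Riemann-Liouville
   integral of order 1 - q of g = W - W(y) with lower limit y.

   For q < alpha, W is Hoelder of some order b in ]q, alpha[.  The integral I is
   then differentiable, with derivative
     g(x) (x - y)^-q - q \int_y^x (g(u) - g(x)) (x - u)^(-q-1) du,
   which is O((x - y)^(b - q)) and so tends to 0 at y.

   For q > alpha, if the derivative of order q existed at y, then I' would be
   bounded near y and |I(x)| <= M (x - y).  At scale h = X / lambda^n the n-th
   term of the series contributes lambda^(-alpha n) h^(1-q) to I(y + h), up to a
   constant bounded below for X = pi or for X = 2 pi, according to the phase
   lambda^n y; for large lambda the lower and higher frequencies perturb this by
   at most one half.  Since alpha + 1 - q < 1, this contradicts the linear bound
   as n tends to infinity. *)

Require Import Defs.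
From mathcomp Require Import all_boot all_order all_algebra.
From mathcomp Require Import all_classical all_reals all_analysis.
From mathcomp Require Import measurable_realfun ring lra.

Set Implicit Arguments.
Unset Strict Implicit.
Unset Printing Implicit Defensive.

Import Order.TTheory GRing.Theory Num.Theory.
Import numFieldNormedType.Exports.

Local Open Scope classical_set_scope.
Local Open Scope ring_scope.

(** * Integrals of weakly singular kernels *)

(** Since W has no derivative to work with, the expansion that makes I differentiable is one of the
    kernel, not of the function. The remainder of order 1 + e of (k + h)^-q at k is estimated with
    the Hoelder weight |k|^b in front. The estimate holds even when h carries the argument across
    the singularity, and it integrates to O(|h|^(1+e)) uniformly in h. In the lower bound, with v =
    u - y, sin(N u) - sin(N y) = cos(N y) sin(N v) - sin(N y) (1 - cos(N v)), and at a single scale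
    the two parts may cancel. The versine part has a positive integral at both scales, while the
    sine part is positive at X = pi and nonpositive at X = 2 pi, so cancellation cannot happen at
    both. The threshold for lambda may depend on s only, yet the error terms carry a factor 1 / (1 -
    q). An order in the set of [critical_order] has all smaller orders below it, so it is enough to
    refute orders between 2 - s and the midpoint (3 - s) / 2 of 2 - s and 1. This bounds 1 / (1 - q)
    in terms of s and keeps the separate case q = 1 away. *)

Lemma cvg_mul_harmonic (R : realType) (c d : R) (m : nat) :
  c + d * (n + m).+1%:R^-1 @[n --> \oo] --> c.
Proof.
rewrite -[X in _ --> X]addr0; apply: cvgD; first exact: cvg_cst.
rewrite -[X in _ --> X](mulr0 d); apply: cvgMr.
have := @cvg_harmonic R; rewrite -(cvg_shiftn m) /=.
by apply: cvg_trans; apply: near_eq_cvg; near=> n.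
Unshelve. all: end_near. Qed.

(** The integrand may blow up at the endpoints, where only the primitive is assumed to have
    one-sided limits. Compact intervals exhaust the open one, the usual theorem applies on each, and
    monotone convergence passes to the limit. Sign alone justifies this, so integrability can be a
    consequence instead of an assumption. *)
Lemma ge0_itvoo_FTC2 (R : realType) (F f : R -> R) (a b : R) : a < b ->
  measurable_fun setT f ->
  {in `]a, b[, forall x, 0 <= f x} -> {in `]a, b[, continuous f} ->
  {in `]a, b[, forall x : R, is_derive x (1 : R) F (f x)} ->
  F x @[x --> a^'+] --> F a -> F x @[x --> b^'-] --> F b ->
  (\int[@lebesgue_measure R]_(x in `[a, b]) (f x)%:E)%E = (F b - F a)%:E.
Proof.
move=> ab mf f0 cf dF Fa Fb.
have d0 : 0 < b - a by rewrite subr_gt0.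
(* The shift by 2 makes the fraction at most 1/3, so [an n < bn n] already at n = 0. *)
pose an (n : nat) := a + (b - a) * (n + 2).+1%:R^-1.
pose bn (n : nat) := b + (- (b - a)) * (n + 2).+1%:R^-1.
have an_gt n : a < an n by rewrite ltrDl mulr_gt0// invr_gt0.
have bn_lt n : bn n < b by rewrite gtrDl mulNr oppr_lt0 mulr_gt0// invr_gt0.
have anbn n : an n < bn n.
  have : ((n + 2).+1%:R : R)^-1 < 2^-1.
    by rewrite ltf_pV2 ?posrE// ltr_nat; rewrite addn2.
  rewrite /an /bn; set t := _^-1 => t2.
  have := @mulr_gt0 R (b - a) (2^-1 - t) d0; rewrite subr_gt0 => /(_ t2).
  by rewrite mulrBr; lra.
have sub n x : x \in `[an n, bn n] -> x \in `]a, b[.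
  rewrite !in_itv/= => /andP[h1 h2].
  by rewrite (lt_le_trans (an_gt n) h1) (le_lt_trans h2 (bn_lt n)).
have subo n x : x \in `]an n, bn n[ -> x \in `]a, b[.
  by move=> h; apply: (sub n); move: h; apply: subset_itv_oo_cc.
have bigU : \bigcup_i `[an i, bn i]%classic = `]a, b[%classic.
  apply/seteqP; split => x /=.
    by move=> [i _ /=]; exact: sub.
  rewrite in_itv/= => /andP[ax xb].
  have anx : \forall n \near \oo, an n < x.
    exact: (cvgr_lt a (@cvg_mul_harmonic R a (b - a) 2)).
  have xbn : \forall n \near \oo, x < bn n.
    exact: (cvgr_gt b (@cvg_mul_harmonic R b (- (b - a)) 2)).
  have : \forall n \near \oo, an n < x /\ x < bn n.
    by apply: filterS2 anx xbn => n h1 h2.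
  move=> [N _ /(_ N (leqnn _))[h1 h2]].
  by exists N => //=; rewrite in_itv/= !ltW.
rewrite integral_itv_bndoo; last first.
  by exact/measurable_EFinP/measurable_funTS.
rewrite -bigU.
have cvI : (\int[@lebesgue_measure R]_(x in `[an i, bn i]) (f x)%:E)%E
    @[i --> \oo] -->
    (\int[@lebesgue_measure R]_(x in \bigcup_i `[an i, bn i]%classic)
        (f x)%:E)%E.
  apply: ge0_nondecreasing_set_cvg_integral => //.
  - apply/nondecreasing_seqP => n; rewrite subsetEset => x /=; rewrite !in_itv/=.
    have le1 : ((n.+1 + 2).+1%:R : R)^-1 <= (n + 2).+1%:R^-1.
      by rewrite lef_pV2 ?posrE// ler_nat.
    move=> /andP[h1 h2]; apply/andP; split.
      by apply: le_trans h1; rewrite lerD2l ler_wpM2l// ltW.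
    by apply: (le_trans h2); rewrite lerD2l !mulNr lerN2 ler_wpM2l// ltW.
  - by move=> i; exact/measurable_EFinP/measurable_funTS.
  - by move=> i x /= /sub xi; rewrite lee_fin f0.
have cvF : (F (bn i) - F (an i))%:E @[i --> \oo] --> (F b - F a)%:E.
  apply: cvg_EFin; first by near=> n.
  apply: cvgB.
    by move/cvg_at_leftP : Fb; apply; split => //; exact: cvg_mul_harmonic.
  by move/cvg_at_rightP : Fa; apply; split => //; exact: cvg_mul_harmonic.
have E i : (\int[@lebesgue_measure R]_(x in `[an i, bn i]) (f x)%:E)%E =
    (F (bn i) - F (an i))%:E.
  have cF x : x \in `]a, b[ -> {for x, continuous F}.
    move=> /dF dFx; apply: differentiable_continuous.
    by apply/derivable1_diffP; exact: ex_derive.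
  rewrite EFinB; apply: continuous_FTC2 => //.
  - apply: continuous_subspace_itv => x xi; apply: cf; exact: sub xi.
  - split.
    + by move=> x /subo /dF dFx; exact: ex_derive.
    + apply: cvg_at_right_filter; apply: cF.
      by apply: (sub i); rewrite in_itv/= lexx ltW.
    + apply: cvg_at_left_filter; apply: cF.
      by apply: (sub i); rewrite in_itv/= lexx ltW.
  - by move=> x /subo /dF dFx; rewrite derive1E derive_val.
rewrite -(cvg_lim _ cvI)// -(cvg_lim _ cvF)//.
by under eq_fun do rewrite E.
Unshelve. all: end_near. Qed.

Lemma ge0_itvoo_FTC2_integrable (R : realType) (F f : R -> R) (a b : R) :
  a < b -> measurable_fun setT f ->
  {in `]a, b[, forall x, 0 <= f x} -> {in `]a, b[, continuous f} ->
  {in `]a, b[, forall x : R, is_derive x (1 : R) F (f x)} ->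
  F x @[x --> a^'+] --> F a -> F x @[x --> b^'-] --> F b ->
  (@lebesgue_measure R).-integrable `[a, b] (EFin \o f).
Proof.
move=> ab mf f0 cf dF Fa Fb; apply/integrableP; split.
  by exact/measurable_EFinP/measurable_funTS.
rewrite integral_itv_bndoo; last first.
  by apply: measurableT_comp => //; exact/measurable_EFinP/measurable_funTS.
suff -> : (\int[@lebesgue_measure R]_(x in `]a, b[) `|(EFin \o f) x|)%E =
    (F b - F a)%:E by rewrite ltry.
rewrite -(ge0_itvoo_FTC2 ab mf f0 cf dF Fa Fb) [RHS]integral_itv_bndoo.
  by apply: eq_integral => x /set_mem /= xab; rewrite ger0_norm// f0.
exact/measurable_EFinP/measurable_funTS.
Qed.

Lemma integrable_setU_EFin d (T : measurableType d) (R : realType)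
    (mu : {measure set T -> \bar R}) (A B : set T) (f : T -> R) :
  measurable A -> measurable B -> [disjoint A & B] ->
  mu.-integrable A (EFin \o f) -> mu.-integrable B (EFin \o f) ->
  mu.-integrable (A `|` B) (EFin \o f).
Proof.
move=> mA mB AB /integrableP[mfA fA] /integrableP[mfB fB].
have mf : measurable_fun (A `|` B) (EFin \o f) by exact/measurable_funU.
apply/integrableP; split => //.
rewrite ge0_integral_setU//; last exact: measurableT_comp.
by rewrite lte_add_pinfty.
Qed.

Lemma integrable_itv_cat (R : realType) (f : R -> R) (a c b : R) :
  a <= c -> c <= b ->
  (@lebesgue_measure R).-integrable `[a, c] (EFin \o f) ->
  (@lebesgue_measure R).-integrable `[c, b] (EFin \o f) ->
  (@lebesgue_measure R).-integrable `[a, b] (EFin \o f).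
Proof.
move=> ac cb fac fcb.
rewrite (@itv_bndbnd_setU _ _ _ (BRight c)) ?bnd_simp//.
apply: integrable_setU_EFin => //=.
- apply/disj_setPLR => x /=; rewrite !in_itv/= => /andP[_ xc] /andP[cx _].
  by move: cx; rewrite ltNge xc.
- apply: integrableS fcb => // x /=.
  by rewrite !in_itv/= => /andP[/ltW -> ->].
Qed.

Lemma Rintegral_itv_cat (R : realType) (f : R -> R) (a c b : R) :
  a <= c -> c <= b ->
  (@lebesgue_measure R).-integrable `[a, b] (EFin \o f) ->
  \int[@lebesgue_measure R]_(x in `[a, b]) f x =
  \int[@lebesgue_measure R]_(x in `[a, c]) f x +
  \int[@lebesgue_measure R]_(x in `[c, b]) f x.
Proof.
move=> ac cb fab.
have fcb : (@lebesgue_measure R).-integrable `]c, b] (EFin \o f).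
  apply: integrableS fab => // x /=.
  by rewrite !in_itv/= => /andP[cx ->]; rewrite (le_trans ac (ltW cx)).
rewrite -(Rintegral_itv_obnd_cbnd fcb) -(Rintegral_itvB fab) ?bnd_simp//.
by rewrite addrCA subrr addr0.
Qed.

Lemma powR_dist_cvg0 (R : realType) (c g : R) : 0 < g ->
  `|c - u| `^ g @[u --> c] --> 0.
Proof.
move=> g0; apply/cvgrPdist_le => e e0.
near=> u; rewrite sub0r normrN ger0_norm ?powR_ge0//.
have -> : e = (e `^ g^-1) `^ g by rewrite -powRrM mulVf ?gt_eqF// powRr1// ltW.
apply: ge0_ler_powR; rewrite ?nnegrE ?powR_ge0// 1?ltW//.
near: u; apply: cvgr_dist_lt; first exact: cvg_id.
exact: powR_gt0.
Unshelve. all: end_near. Qed.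

Lemma measurable_powR_dist (R : realType) (c g : R) :
  measurable_fun setT (fun u : R => `|c - u| `^ g).
Proof.
apply: (measurableT_comp (measurable_powR _)) => //.
by apply: measurableT_comp => //; apply: measurable_funB.
Qed.

Lemma is_derive_norm_powR_left (R : realType) (c g u : R) : u < c ->
  is_derive u (1 : R) (fun u => `|c - u| `^ g) (- (g * `|c - u| `^ (g - 1))).
Proof.
move=> uc.
have cu0 : 0 < c - u by rewrite subr_gt0.
have D : is_derive u (1 : R) (fun u => (c - u) `^ g) (- (g * `|c - u| `^ (g - 1))).
  rewrite (gtr0_norm cu0).
  have H := is_derive1_powR g cu0.
  have H2 : is_derive u (1 : R) (fun u => c - u) (-1).
    by apply: is_derive_eq; ring.
  have := @is_derive1_comp R (fun x => x `^ g) (fun u => c - u) u _ _ H H2.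
  by rewrite mulrN1.
apply: (near_eq_is_derive _ D).
near=> v; rewrite ger0_norm// subr_ge0 ltW//.
by near: v; exact: lt_nbhsl.
Unshelve. all: end_near. Qed.

Lemma is_derive_powR_dist_right (R : realType) (c g u : R) : c < u ->
  is_derive u (1 : R) (fun u => `|c - u| `^ g) (g * `|c - u| `^ (g - 1)).
Proof.
move=> uc.
have cu0 : 0 < u - c by rewrite subr_gt0.
have D : is_derive u (1 : R) (fun u => (u - c) `^ g) (g * `|c - u| `^ (g - 1)).
  rewrite distrC (gtr0_norm cu0).
  have H := is_derive1_powR g cu0.
  have H2 : is_derive u (1 : R) (fun u => u - c) 1.
    by apply: is_derive_eq; ring.
  have := @is_derive1_comp R (fun x => x `^ g) (fun u => u - c) u _ _ H H2.
  by rewrite mulr1.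
apply: (near_eq_is_derive _ D).
near=> v; rewrite distrC ger0_norm// subr_ge0 ltW//.
by near: v; exact: lt_nbhsr.
Unshelve. all: end_near. Qed.

Lemma is_derive1_continuous (R : realType) (f : R -> R) (x d : R) :
  is_derive x (1 : R) f d -> {for x, continuous f}.
Proof.
move=> df; apply: differentiable_continuous.
by apply/derivable1_diffP; exact: ex_derive.
Qed.

Lemma powR_dist_continuous (R : realType) (c g x : R) : 0 < g ->
  {for x, continuous (fun u : R => `|c - u| `^ g)}.
Proof.
move=> g0; have [xc|cx|->] := ltgtP x c.
- exact: is_derive1_continuous (is_derive_norm_powR_left g xc).
- exact: is_derive1_continuous (is_derive_powR_dist_right g cx).
- rewrite /prop_for /continuous_at subrr normr0 powR0 ?gt_eqF//.
  exact: powR_dist_cvg0.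
Qed.

(** For g < 1 the integrand is singular at c, but 0 < g keeps its primitive continuous there, which
    is all that [ge0_itvoo_FTC2] asks of an endpoint. *)
Lemma weak_kernel_left_lt (R : realType) (g a c : R) : 0 < g -> a < c ->
  (@lebesgue_measure R).-integrable `[a, c] (EFin \o fun u => `|c - u| `^ (g - 1)) /\
  \int[@lebesgue_measure R]_(u in `[a, c]) (`|c - u| `^ (g - 1)) = (c - a) `^ g / g.
Proof.
move=> g0 ac.
pose F (u : R) := - (g^-1 * `|c - u| `^ g).
have Fc x : {for x, continuous F}.
  apply: continuousN; apply: continuousM; first exact: cst_continuous.
  exact: powR_dist_continuous.
have H1 : {in `]a, c[, forall x, 0 <= `|c - x| `^ (g - 1)}.
  by move=> x _; exact: powR_ge0.
have H2 : {in `]a, c[, continuous (fun u => `|c - u| `^ (g - 1))}.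
  move=> x; rewrite in_itv/= => /andP[_ xc].
  exact: is_derive1_continuous (is_derive_norm_powR_left _ xc).
have H3 : {in `]a, c[, forall x : R, is_derive x (1 : R) F (`|c - x| `^ (g - 1))}.
  move=> x; rewrite in_itv/= => /andP[_ xc].
  have D := is_derive_norm_powR_left g xc.
  rewrite -[X in is_derive _ _ _ X](_ : - (g^-1 *: (- (g * `|c - x| `^ (g - 1)))) = _).
    by apply: is_deriveN; apply: is_deriveZ.
  by rewrite scalerN opprK /GRing.scale/= mulKf ?gt_eqF.
have FA := cvg_at_right_filter (Fc a).
have FB := cvg_at_left_filter (Fc c).
have mf := @measurable_powR_dist R c (g - 1).
split; first exact: ge0_itvoo_FTC2_integrable mf H1 H2 H3 FA FB.
rewrite /Rintegral (ge0_itvoo_FTC2 ac mf H1 H2 H3 FA FB) /F/=.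
rewrite subrr normr0 powR0 ?gt_eqF// mulr0 oppr0 sub0r opprK mulrC.
by rewrite ger0_norm// subr_ge0 ltW.
Qed.

Lemma weak_kernel_left (R : realType) (g a c : R) : 0 < g -> a <= c ->
  (@lebesgue_measure R).-integrable `[a, c] (EFin \o fun u => `|c - u| `^ (g - 1)) /\
  \int[@lebesgue_measure R]_(u in `[a, c]) (`|c - u| `^ (g - 1)) = (c - a) `^ g / g.
Proof.
move=> g0; rewrite le_eqVlt => /predU1P[->|]; last first.
  exact: weak_kernel_left_lt.
rewrite subrr powR0 ?gt_eqF// mul0r set_itv1 Rintegral_set1; split=> //.
have c1c : c - 1 < c by rewrite ltrBlDr ltrDl.
apply: integrableS (weak_kernel_left_lt g0 c1c).1 => // x /= ->.
by rewrite in_itv/= lexx ltW.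
Qed.
Lemma weak_kernel_right_lt (R : realType) (g c b : R) : 0 < g -> c < b ->
  (@lebesgue_measure R).-integrable `[c, b] (EFin \o fun u => `|c - u| `^ (g - 1)) /\
  \int[@lebesgue_measure R]_(u in `[c, b]) (`|c - u| `^ (g - 1)) = (b - c) `^ g / g.
Proof.
move=> g0 cb.
pose F (u : R) := g^-1 * `|c - u| `^ g.
have Fc x : {for x, continuous F}.
  apply: continuousM; first exact: cst_continuous.
  exact: powR_dist_continuous.
have H1 : {in `]c, b[, forall x, 0 <= `|c - x| `^ (g - 1)}.
  by move=> x _; exact: powR_ge0.
have H2 : {in `]c, b[, continuous (fun u => `|c - u| `^ (g - 1))}.
  move=> x; rewrite in_itv/= => /andP[cx _].
  exact: is_derive1_continuous (is_derive_powR_dist_right _ cx).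
have H3 : {in `]c, b[, forall x : R, is_derive x (1 : R) F (`|c - x| `^ (g - 1))}.
  move=> x; rewrite in_itv/= => /andP[cx _].
  have D := is_derive_powR_dist_right g cx.
  rewrite -[X in is_derive _ _ _ X](_ : g^-1 *: (g * `|c - x| `^ (g - 1)) = _).
    exact: is_deriveZ.
  by rewrite /GRing.scale/= mulKf ?gt_eqF.
have FA := cvg_at_right_filter (Fc c).
have FB := cvg_at_left_filter (Fc b).
have mf := @measurable_powR_dist R c (g - 1).
split; first exact: ge0_itvoo_FTC2_integrable mf H1 H2 H3 FA FB.
rewrite /Rintegral (ge0_itvoo_FTC2 cb mf H1 H2 H3 FA FB) /F/=.
rewrite subrr normr0 powR0 ?gt_eqF// mulr0 subr0 mulrC.
by rewrite distrC ger0_norm// subr_ge0 ltW.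
Qed.

Lemma weak_kernel_right (R : realType) (g c b : R) : 0 < g -> c <= b ->
  (@lebesgue_measure R).-integrable `[c, b] (EFin \o fun u => `|c - u| `^ (g - 1)) /\
  \int[@lebesgue_measure R]_(u in `[c, b]) (`|c - u| `^ (g - 1)) = (b - c) `^ g / g.
Proof.
move=> g0; rewrite le_eqVlt => /predU1P[->|]; last first.
  exact: weak_kernel_right_lt.
rewrite subrr powR0 ?gt_eqF// mul0r set_itv1 Rintegral_set1; split=> //.
have bb1 : b < b + 1 by rewrite ltrDl.
apply: integrableS (weak_kernel_right_lt g0 bb1).1 => // x /= ->.
by rewrite in_itv/= lexx ltW.
Qed.
(** The singularity may lie anywhere: the interval is enlarged so as to contain c, then cut at c. *)
Lemma weak_kernel_integrable (R : realType) (g a b c : R) : 0 < g ->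
  (@lebesgue_measure R).-integrable `[a, b]
    (EFin \o fun u => `|c - u| `^ (g - 1)).
Proof.
move=> g0.
have ac : Num.min a c <= c by rewrite ge_min lexx orbT.
have cb : c <= Num.max b c by rewrite le_max lexx orbT.
have := integrable_itv_cat ac cb (weak_kernel_left g0 ac).1
  (weak_kernel_right g0 cb).1.
apply: integrableS => // x /=; rewrite !in_itv/= => /andP[h1 h2].
by rewrite ge_min h1 le_max h2.
Qed.

(** Each side of c contributes at most what the full length would. The bound is independent of c,
    which matters when the singularity moves with the increment h. *)
Lemma weak_kernel_integral_le (R : realType) (g a b c : R) : 0 < g ->
  a <= c <= b ->
  \int[@lebesgue_measure R]_(u in `[a, b]) (`|c - u| `^ (g - 1)) <=
  2 * (b - a) `^ g / g.
Proof.
move=> g0 /andP[ac cb].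
rewrite (Rintegral_itv_cat ac cb); last exact: weak_kernel_integrable.
rewrite (weak_kernel_left g0 ac).2 (weak_kernel_right g0 cb).2 -mulrDl.
apply: ler_wpM2r; first by rewrite invr_ge0 ltW.
rewrite mulr2n mulrDl mul1r.
have ab := le_trans ac cb.
by apply: lerD; apply: ge0_ler_powR;
  rewrite ?nnegrE ?subr_ge0 ?(ltW g0) ?lerD2r ?lerD2l ?lerN2.
Qed.

(** * The truncated power kernel *)

(** Young's inequality with exponents 1/q and 1/(1-q), applied to (1 + x)^q and 1. *)
Lemma powR_bernoulli (R : realType) (q x : R) : 0 < q < 1 -> -1 <= x ->
  (1 + x) `^ q <= 1 + q * x.
Proof.
move=> /andP[q0 q1] x1.
have x0 : 0 <= 1 + x by lra.
have q'0 : 0 < 1 - q by lra.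
have := @conjugate_powR R ((1 + x) `^ q) 1 q^-1 (1 - q)^-1 (powR_ge0 _ _) ler01.
rewrite !invr_gt0 q0 q'0 !invrK => /(_ isT isT).
rewrite addrCA subrr addr0 => /(_ erefl).
rewrite mulr1 -powRrM mulfV ?gt_eqF// powRr1// powR1 mul1r.
by move=> h; apply: (le_trans h); lra.
Qed.

(** Bernoulli for q gives the sign of the remainder. Bernoulli for 1 - q, after writing (1 + t)^-q
    as (1 + t)^(1-q) / (1 + t), bounds it by q t^2 / (1 + t), hence by both t^2 and t. The first is
    below t^(1+e) for t <= 1, the second for t >= 1. *)
Lemma powR_opp_taylor_right (R : realType) (q e t : R) :
  0 < q < 1 -> 0 < e < 1 -> 0 < t ->
  `|(1 + t) `^ (- q) - 1 + q * t| <= t `^ (1 + e).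
Proof.
move=> q01 /andP[e0 e1] t0; have [q0 q1] := andP q01.
have t10 : 0 < 1 + t by lra.
have B1 : (1 + t) `^ q <= 1 + q * t by apply: powR_bernoulli => //; lra.
have B2 : (1 + t) `^ (1 - q) <= 1 + (1 - q) * t.
  by apply: powR_bernoulli; lra.
have P0 : 0 < (1 + t) `^ q by exact: powR_gt0.
have L : 1 - q * t <= (1 + t) `^ (- q).
  rewrite powRN -[leRHS]mul1r ler_pdivlMr//.
  have [h|h] := leP 0 (1 - q * t).
    by apply: (le_trans (ler_wpM2l h B1)); have := sqr_ge0 (q * t); lra.
  by apply: (@le_trans _ _ 0) => //; rewrite mulr_le0_ge0// ltW.
have U : (1 + t) `^ (- q) <= (1 + (1 - q) * t) / (1 + t).
  rewrite ler_pdivlMr//; apply: le_trans B2.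
  have q'0 : 0 < 1 - q by lra.
  have := mulr_powRB1 (ltW t10) q'0; rewrite (_ : 1 - q - 1 = - q); last by ring.
  by rewrite mulrC => ->.
have U2 : (1 + (1 - q) * t) / (1 + t) - 1 + q * t = q * (t * t) / (1 + t).
  by field; lra.
rewrite ger0_norm; last by lra.
have {}U : (1 + t) `^ (- q) - 1 + q * t <= q * (t * t) / (1 + t).
  by rewrite -U2; lra.
apply: (le_trans U); rewrite powRD ?(gt_eqF t0) ?implybT// powRr1 ?(ltW t0)//.
have [t1|t1] := leP t 1.
  have H : t <= t `^ e by apply: ger1_powR; [rewrite t0|exact: ltW].
  apply: (@le_trans _ _ (t * t)); last by rewrite ler_wpM2l// ltW.
  rewrite ler_pdivrMr//; have tt0 : 0 < t * t by rewrite mulr_gt0.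
  have := mulr_gt0 tt0 t0; have : q * (t * t) < t * t by rewrite gtr_pMl.
  lra.
have H : 1 <= t `^ e.
  by rewrite -[leLHS](powRr0 t); apply: ler_powR; exact: ltW.
apply: (@le_trans _ _ (t * 1)); last by rewrite ler_wpM2l// ltW.
rewrite ler_pdivrMr//; have tt0 : 0 < t * t by rewrite mulr_gt0.
have : q * (t * t) < t * t by rewrite gtr_pMl.
lra.
Qed.

(** The factor (1 - t)^-q on the right absorbs the blow-up at t = 1. The upper bound comes from 1 -
    t^2 <= (1 - t^2)^q = (1 + t)^q (1 - t)^q <= (1 + q t) (1 - t)^q, which gives a remainder of at
    most t^2 (1 - t)^-q. *)
Lemma powR_opp_taylor_left (R : realType) (q e t : R) :
  0 < q < 1 -> 0 < e < 1 -> 0 < t < 1 ->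
  `|(1 - t) `^ (- q) - 1 - q * t| <= t `^ (1 + e) * (1 - t) `^ (- q).
Proof.
move=> q01 /andP[e0 e1] /andP[t0 t1]; have [q0 q1] := andP q01.
have t10 : 0 < 1 - t by lra.
have B1 : (1 - t) `^ q <= 1 + q * (- t) by apply: powR_bernoulli => //; lra.
have B2 : (1 + t) `^ q <= 1 + q * t by apply: powR_bernoulli => //; lra.
have P0 : 0 < (1 - t) `^ q by exact: powR_gt0.
have B3 : 1 - t * t <= (1 + t) `^ q * (1 - t) `^ q.
  rewrite -powRM; [|lra..].
  have -> : (1 + t) * (1 - t) = 1 - t * t by ring.
  have tt0 : 0 < t * t by rewrite mulr_gt0.
  have tt1 : t * t < 1 by rewrite mulr_ilt1// ltW.
  by apply: ger1_powR; [apply/andP; split; lra | exact: ltW].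
have P : (1 - t) `^ (- q) = ((1 - t) `^ q)^-1 by rewrite powRN.
have L : 1 + q * t <= (1 - t) `^ (- q).
  rewrite P -[leRHS]mul1r ler_pdivlMr//.
  have qt0 : 0 < q * t by rewrite mulr_gt0.
  have h : 0 <= 1 + q * t by lra.
  by apply: (le_trans (ler_wpM2l h B1)); have := sqr_ge0 (q * t); lra.
rewrite ger0_norm; last by lra.
have tt : t * t <= t `^ (1 + e).
  rewrite powRD ?(gt_eqF t0) ?implybT// powRr1 ?(ltW t0)// ler_wpM2l ?(ltW t0)//.
  by apply: ger1_powR; [rewrite t0 ltW|exact: ltW].
apply: (@le_trans _ _ (t * t * (1 - t) `^ (- q))); last first.
  by rewrite ler_wpM2r// powR_ge0.
have H : (1 - t * t) * (1 - t) `^ (- q) <= 1 + q * t.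
  rewrite P ler_pdivrMr//; apply: (le_trans B3).
  by rewrite ler_wpM2r// ltW.
by move: H; rewrite mulrBl mul1r; lra.
Qed.

Lemma le0_powR_le (R : realType) (p x y : R) : p <= 0 -> 0 < x -> x <= y ->
  y `^ p <= x `^ p.
Proof.
move=> p0 x0 xy; have y0 := lt_le_trans x0 xy.
rewrite -(opprK p) !(powRN _ (- p)) lef_pV2 ?posrE ?powR_gt0//.
by apply: ge0_ler_powR; rewrite ?nnegrE ?oppr_ge0 ?(ltW x0) ?(ltW y0).
Qed.

(* Extending (x - u)^-q by 0 to u >= x makes the domain of integration
   independent of x. *)
Definition RL_kernel (R : realType) (q v : R) : R :=
  if 0 < v then v `^ (- q) else 0.

Definition RL_kernel_der (R : realType) (q v : R) : R :=
  if 0 < v then - q * v `^ (- q - 1) else 0.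

(* The exponent 1 + e, between the first and the second order, keeps the right
   member integrable in k when e < b - q. *)
Lemma RL_kernel_taylor (R : realType) (q b e k h : R) :
  0 < q < 1 -> 0 < b < 1 -> 0 < e < 1 ->
  `|k| `^ b * `|RL_kernel q (k + h) - RL_kernel q k - h * RL_kernel_der q k| <=
  2 * `|h| `^ (1 + e) * (`|k| `^ (b - q - e - 1) + `|k + h| `^ (b - q - e - 1)).
Proof.
move=> q01 b01 e01.
have [q0 q1] := andP q01; have [b0 b1] := andP b01; have [e0 e1] := andP e01.
rewrite /RL_kernel /RL_kernel_der -mulrA mulrDr.
set A := `|h| `^ (1 + e) * `|k| `^ _; set B := `|h| `^ (1 + e) * `|k + h| `^ _.
have A0 : 0 <= A by rewrite /A mulr_ge0// powR_ge0.
have B0 : 0 <= B by rewrite /B mulr_ge0// powR_ge0.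
(* For k <= 0 only the kernel at k + h can survive. Then |k| <= h and 0 < k + h <= h, and the term
   singular at k + h dominates. *)
have [k0|k0] := ltP 0 k; last first.
  have [kh0|kh0] := ltP 0 (k + h); last first.
    by rewrite mulr0 !subr0 normr0 mulr0; lra.
  rewrite mulr0 !subr0 (@ger0_norm _ (_ `^ _)) ?powR_ge0//.
  have h0 : 0 < h by lra.
  apply: (@le_trans _ _ B); last by lra.
  rewrite /B (gtr0_norm h0) (gtr0_norm kh0).
  have -> : b - q - e - 1 = (b - 1 - e) + - q by ring.
  rewrite (@powRD _ (k + h) (b - 1 - e)); last by rewrite (gt_eqF kh0) implybT.
  rewrite mulrA ler_wpM2r ?powR_ge0//.
  have kb : `|k| `^ b <= h `^ b.
    by apply: ge0_ler_powR; rewrite ?nnegrE ?(ltW b0) ?(ltW h0)// ler0_norm//; lra.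
  apply: (le_trans kb).
  have -> : h `^ b = h `^ (1 + e) * h `^ (b - 1 - e).
    by rewrite -powRD ?(gt_eqF h0) ?implybT//; congr (_ `^ _); ring.
  rewrite ler_wpM2l ?powR_ge0//; apply: le0_powR_le => //; lra.
have k1 : k `^ (- q - 1) = k `^ (- q) / k.
  by rewrite powRB ?(gt_eqF k0) ?implybT// powRr1// (ltW k0).
have kbq : k `^ b * k `^ (- q) = k `^ (b - q).
  by rewrite -powRD ?(gt_eqF k0) ?implybT.
(* For k > 0 both sides are homogeneous of degree b - q. Putting |h| = k t reduces every remaining
   case to an inequality in t alone. *)
have scale t : 0 < t -> (k * t) `^ (1 + e) * k `^ (b - q - e - 1) =
    k `^ (b - q) * t `^ (1 + e).
  move=> t0; rewrite powRM ?(ltW k0) ?(ltW t0)// mulrAC -powRD ?(gt_eqF k0) ?implybT//.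
  by congr (_ `^ _ * _); ring.
(* When k + h <= 0 one has t >= 1, and the remainder is k^-q (1 + q t) with both 1 and q t below
   t^(1+e). This is the case that accounts for the factor 2. *)
have [kh0|kh0] := ltP 0 (k + h); last first.
  pose t := - h / k.
  have hE : h = - (k * t) by rewrite /t; field; lra.
  have t1 : 1 <= t by rewrite /t ler_pdivlMr//; lra.
  have t0 : 0 < t by lra.
  apply: (@le_trans _ _ (2 * A)); last by lra.
  rewrite /A hE normrN (gtr0_norm k0) (gtr0_norm (mulr_gt0 k0 t0)) scale// k1.
  have -> : 0 - k `^ (- q) - - (k * t) * (- q * (k `^ (- q) / k)) =
      k `^ (- q) * (- (1 + q * t)) by field; lra.
  have qt0 : 0 < q * t by rewrite mulr_gt0.
  rewrite normrM normrN !ger0_norm ?powR_ge0//; last by lra.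
  rewrite [leLHS]mulrA kbq [leRHS]mulrCA ler_wpM2l ?powR_ge0//.
  have : t <= t `^ (1 + e) by apply: le1r_powR => //; lra.
  have : q * t < t by rewrite gtr_pMl.
  lra.
have [h0|h0|h0] := ltgtP 0 h.
- pose t := h / k.
  have hE : h = k * t by rewrite /t; field; lra.
  have t0 : 0 < t by rewrite divr_gt0.
  apply: (@le_trans _ _ A); last by lra.
  rewrite /A hE (gtr0_norm k0) (gtr0_norm (mulr_gt0 k0 t0)) scale// k1.
  have -> : k + k * t = k * (1 + t) by ring.
  rewrite powRM ?(ltW k0)//; last by lra.
  have -> : k `^ (- q) * (1 + t) `^ (- q) - k `^ (- q) -
     k * t * (- q * (k `^ (- q) / k)) =
     k `^ (- q) * ((1 + t) `^ (- q) - 1 + q * t) by field; lra.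
  rewrite normrM (@ger0_norm _ (_ `^ _)) ?powR_ge0// [leLHS]mulrA kbq.
  by rewrite ler_wpM2l ?powR_ge0//; exact: powR_opp_taylor_right.
(* As t approaches 1 the remainder blows up, so the term singular at k + h has to be used. Its
   exponent in 1 - t is -q lowered further by 1 + e - b > 0, which only enlarges it. *)
- pose t := - h / k.
  have hE : h = - (k * t) by rewrite /t; field; lra.
  have t0 : 0 < t by rewrite divr_gt0// oppr_gt0.
  have t1 : t < 1 by rewrite /t ltr_pdivrMr//; lra.
  apply: (@le_trans _ _ B); last by lra.
  have -> : B = k `^ (b - q) * (t `^ (1 + e) * (1 - t) `^ (b - q - e - 1)).
    rewrite /B (gtr0_norm kh0) hE normrN (gtr0_norm (mulr_gt0 k0 t0)).
    have -> : k + - (k * t) = k * (1 - t) by ring.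
    rewrite (@powRM _ k (1 - t)) ?(ltW k0)//; last by lra.
    by rewrite mulrA scale// -mulrA.
  rewrite (gtr0_norm k0) hE k1.
  have -> : k + - (k * t) = k * (1 - t) by ring.
  rewrite powRM ?(ltW k0)//; last by lra.
  have -> : k `^ (- q) * (1 - t) `^ (- q) - k `^ (- q) -
     - (k * t) * (- q * (k `^ (- q) / k)) =
     k `^ (- q) * ((1 - t) `^ (- q) - 1 - q * t) by field; lra.
  rewrite normrM (@ger0_norm _ (_ `^ _)) ?powR_ge0// [leLHS]mulrA kbq.
  rewrite ler_wpM2l ?powR_ge0//.
  have t01 : 0 < t < 1 by rewrite t0 t1.
  apply: (le_trans (powR_opp_taylor_left q01 e01 t01)).
  rewrite ler_wpM2l ?powR_ge0//.
  have -> : b - q - e - 1 = - (1 + e - b) + - q by ring.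
  have t1' : 0 < 1 - t by lra.
  rewrite (@powRD _ (1 - t)); last by rewrite (gt_eqF t1') implybT.
  rewrite ler_peMl ?powR_ge0//.
  apply: (@le_trans _ _ (1 `^ (- (1 + e - b)))); first by rewrite powR1.
  by apply: le0_powR_le; lra.
- by rewrite -h0 addr0 mul0r subrr subr0 normr0 mulr0; lra.
Qed.

(** * Riemann-Liouville integrals of Hoelder functions *)

Lemma Rintegral_eq0 (R : realType) (D : set R) (f : R -> R) :
  {in D, forall x, f x = 0} -> \int[@lebesgue_measure R]_(x in D) f x = 0.
Proof.
move=> f0; transitivity (\int[@lebesgue_measure R]_(x in D) (0 : R)).
  exact: eq_Rintegral.
by rewrite /Rintegral integral0.
Qed.

Lemma integrable_dominated (R : realType) (D : set R) (f g : R -> R) :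
  measurable D -> measurable_fun D f -> (forall x, D x -> `|f x| <= g x) ->
  (@lebesgue_measure R).-integrable D (EFin \o g) ->
  (@lebesgue_measure R).-integrable D (EFin \o f).
Proof.
move=> mD mf fg; apply: le_integrable => //; first exact/measurable_EFinP.
by move=> x Dx /=; rewrite lee_fin (le_trans (fg x Dx))// ler_norm.
Qed.

Lemma le_norm_Rintegral_dominated (R : realType) (D : set R) (f g : R -> R) :
  measurable D -> measurable_fun D f -> (forall x, D x -> `|f x| <= g x) ->
  (@lebesgue_measure R).-integrable D (EFin \o g) ->
  `|\int[@lebesgue_measure R]_(x in D) f x| <=
  \int[@lebesgue_measure R]_(x in D) g x.
Proof.
move=> mD mf fg ig; have jf := integrable_dominated mD mf fg ig.
apply: le_trans; first by apply: le_normr_Rintegral jf.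
by apply: le_Rintegral => //; exact: integrable_norm.
Qed.

(** The exponent stays in the form [1 - q - 1] to match the weak kernel lemmas, stated for [g - 1]
    with 0 < g. *)
Lemma RL_integrandE (R : realType) (q : R) (g : R -> R) (z u : R) : u <= z ->
  RL_integrand q g z u = g u * `|z - u| `^ (1 - q - 1).
Proof.
move=> uz; rewrite /RL_integrand ger0_norm ?subr_ge0// -powRN.
by congr (_ * _ `^ _); ring.
Qed.

Lemma measurable_RL_integrand (R : realType) (q : R) (g : R -> R) (z : R) :
  measurable_fun setT g -> measurable_fun setT (RL_integrand q g z).
Proof.
move=> mg; rewrite /RL_integrand.
rewrite (_ : (fun u => _) = (fun u => g u * (z - u) `^ (- q))); last first.
  by apply/funext => u; rewrite powRN.
apply: measurable_funM => //.
by apply: (measurableT_comp (measurable_powR _)) => //; exact: measurable_funB.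
Qed.

Lemma RL_integrand_dominated (R : realType) (q : R) (g : R -> R) (a z B : R) :
  (forall u, u \in `[a, z] -> `|g u| <= B) ->
  forall u, `[a, z]%classic u ->
    `|RL_integrand q g z u| <= B * `|z - u| `^ (1 - q - 1).
Proof.
move=> gB u /[dup] /= uaz; rewrite in_itv/= => /andP[au uz].
rewrite RL_integrandE// normrM (@ger0_norm _ (_ `^ _)) ?powR_ge0//.
by rewrite ler_wpM2r ?powR_ge0// gB.
Qed.

Lemma integrableZl_EFin (R : realType) (D : set R) (k : R) (f : R -> R) :
  measurable D -> (@lebesgue_measure R).-integrable D (EFin \o f) ->
  (@lebesgue_measure R).-integrable D (EFin \o fun x => k * f x).
Proof.
move=> mD jf; have := @integrableZl _ _ R (@lebesgue_measure R) D mD k _ jf.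
by apply: eq_integrable => // x _ /=; rewrite EFinM.
Qed.

Lemma RL_integrand_integrable (R : realType) (q : R) (g : R -> R) (a z B : R) :
  q < 1 -> measurable_fun setT g ->
  (forall u, u \in `[a, z] -> `|g u| <= B) ->
  (@lebesgue_measure R).-integrable `[a, z] (EFin \o RL_integrand q g z).
Proof.
move=> q1 mg gB.
apply: (integrable_dominated _ _ (RL_integrand_dominated q gB)) => //.
  by apply: measurable_funTS; exact: measurable_RL_integrand.
apply: integrableZl_EFin => //; apply: weak_kernel_integrable.
by rewrite subr_gt0.
Qed.

Lemma RL_integral_le (R : realType) (q : R) (g : R -> R) (a z B : R) :
  q < 1 -> a <= z -> measurable_fun setT g ->
  (forall u, u \in `[a, z] -> `|g u| <= B) ->
  `|RL_integral q a g z| <= B * ((z - a) `^ (1 - q) / (1 - q)).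
Proof.
move=> q1 az mg gB; have q10 : 0 < 1 - q by rewrite subr_gt0.
rewrite -(weak_kernel_left q10 az).2 -RintegralZl//; last first.
  exact: weak_kernel_integrable.
apply: (le_norm_Rintegral_dominated _ _ (RL_integrand_dominated q gB)) => //.
  by apply: measurable_funTS; exact: measurable_RL_integrand.
by apply: integrableZl_EFin => //; exact: weak_kernel_integrable.
Qed.

Lemma measurable_RL_kernel (R : realType) (q z : R) :
  measurable_fun setT (fun u : R => RL_kernel q (z - u)).
Proof.
apply: measurable_fun_ifT => //.
  by apply: measurable_fun_ltr => //; exact: measurable_funB.
by apply: (measurableT_comp (measurable_powR _)) => //; exact: measurable_funB.
Qed.

Lemma measurable_RL_kernel_der (R : realType) (q z : R) :
  measurable_fun setT (fun u : R => RL_kernel_der q (z - u)).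
Proof.
apply: measurable_fun_ifT => //.
  by apply: measurable_fun_ltr => //; exact: measurable_funB.
apply: measurable_funM => //.
by apply: (measurableT_comp (measurable_powR _)) => //; exact: measurable_funB.
Qed.

Lemma RL_kernel_le (R : realType) (q v : R) :
  `|RL_kernel q v| <= `|v| `^ (1 - q - 1).
Proof.
rewrite /RL_kernel; have [v0|v0] := ltP 0 v; last by rewrite normr0 powR_ge0.
rewrite ger0_norm ?powR_ge0// gtr0_norm// le_eqVlt; apply/predU1P; left.
by congr (_ `^ _); ring.
Qed.

Lemma RL_integral_kernelE (R : realType) (q : R) (g : R -> R) (a x c B : R) :
  0 < q < 1 -> a <= x -> x <= c -> measurable_fun setT g ->
  (forall u, u \in `[a, c] -> `|g u| <= B) ->
  (@lebesgue_measure R).-integrable `[a, c]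
    (EFin \o fun u => g u * RL_kernel q (x - u)) /\
  RL_integral q a g x =
  \int[@lebesgue_measure R]_(u in `[a, c]) (g u * RL_kernel q (x - u)).
Proof.
move=> /andP[q0 q1] ax xc mg gB.
have I : (@lebesgue_measure R).-integrable `[a, c]
    (EFin \o fun u => g u * RL_kernel q (x - u)).
  apply: (@integrable_dominated _ _ _ (fun u => B * `|x - u| `^ (1 - q - 1))) => //.
  - apply: measurable_funTS; apply: measurable_funM => //.
    exact: measurable_RL_kernel.
  - move=> u uac; rewrite normrM ler_pM//; first exact: gB.
    exact: RL_kernel_le.
  - apply: integrableZl_EFin => //; apply: weak_kernel_integrable.
    by rewrite subr_gt0.
split=> //; rewrite (Rintegral_itv_cat ax xc I).
rewrite [X in _ + X]Rintegral_eq0 ?addr0; last first.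
  move=> u; rewrite inE/= in_itv/= => /andP[xu _].
  by rewrite /RL_kernel subr_gt0 ltNge xu/= mulr0.
apply: eq_Rintegral => u; rewrite inE/= in_itv/= => /andP[_ ux].
rewrite /RL_integrand /RL_kernel subr_gt0.
(* At u = x both conventions give 0: [RL_integrand] through the inverse of 0, [RL_kernel] through
   its test. *)
move: ux; rewrite le_eqVlt => /predU1P[->|->]; last by rewrite powRN.
by rewrite ltxx mulr0 subrr powR0 ?gt_eqF// invr0 mulr0.
Qed.

Lemma is_derive_remainder (R : realType) (F : R -> R) (x D M e : R) : 0 < e ->
  (\forall h \near (0 : R), `|F (x + h) - F x - h * D| <= M * `|h| `^ (1 + e)) ->
  is_derive x (1 : R) F D.
Proof.
move=> e0 near_bound.
have cvD : h^-1 *: (F (h *: (1 : R) + x) - F x) @[h --> (0 : R)^'] --> D.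
  apply/cvgrPdist_le => eps eps0.
  have Me : \forall h \near (0 : R)^', `|M| * `|0 - h| `^ e <= eps.
    have : `|M| * `|0 - h| `^ e @[h --> (0 : R)] --> `|M| * 0.
      by apply: cvgMr; exact: powR_dist_cvg0.
    rewrite mulr0 => /cvgrPdist_le /(_ eps eps0).
    move=> H; apply: nbhs_dnbhs; move: H; apply: filterS => h.
    by rewrite sub0r normrN; apply: le_trans; exact: ler_norm.
  have nb := nbhs_dnbhs near_bound.
  near=> h.
  have h0 : h != 0 by near: h; exact: nbhs_dnbhs_neq.
  have -> : D - h^-1 *: (F (h *: (1 : R) + x) - F x) =
      - (h^-1 * (F (x + h) - F x - h * D)).
    by rewrite /GRing.scale/= mulr1 (addrC h x); field.
  rewrite normrN normrM normfV ler_pdivrMl ?normr_gt0//.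
  have Hb : `|F (x + h) - F x - h * D| <= M * `|h| `^ (1 + e) by near: h.
  apply: (le_trans Hb).
  have He : `|M| * `|0 - h| `^ e <= eps by near: h.
  rewrite powRD ?normr_eq0 ?h0 ?implybT// powRr1// mulrCA ler_wpM2l//.
  apply: le_trans He; rewrite sub0r normrN ler_wpM2r ?powR_ge0//.
  exact: ler_norm.
have dF : derivable F x (1 : R) by apply/cvg_ex; exists D.
by split => //; exact: cvg_lim cvD.
Unshelve. all: end_near. Qed.

Lemma norm_powR_le (R : realType) (b u v : R) : 0 <= b ->
  `|u| <= v -> `|u| `^ b <= v `^ b.
Proof.
move=> b0 uv; apply: ge0_ler_powR => //; rewrite nnegrE//.
exact: le_trans uv.
Qed.

Lemma RL_integral_cst (R : realType) (q a x k : R) : q < 1 -> a <= x ->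
  RL_integral q a (fun=> k) x = k * ((x - a) `^ (1 - q) / (1 - q)).
Proof.
move=> q1 ax; have q10 : 0 < 1 - q by rewrite subr_gt0.
rewrite -(weak_kernel_left q10 ax).2 -RintegralZl//; last first.
  exact: weak_kernel_integrable.
apply: eq_Rintegral => u; rewrite inE/= in_itv/= => /andP[_ ux].
exact: RL_integrandE.
Qed.

Lemma RL_integralD (R : realType) (q a x A B : R) (f g : R -> R) : q < 1 ->
  measurable_fun setT f -> measurable_fun setT g ->
  (forall u, u \in `[a, x] -> `|f u| <= A) ->
  (forall u, u \in `[a, x] -> `|g u| <= B) ->
  RL_integral q a (fun u => f u + g u) x =
  RL_integral q a f x + RL_integral q a g x.
Proof.
move=> q1 mf mg fA gB; rewrite -RintegralD//=.
- by apply: eq_Rintegral => u _; rewrite /RL_integrand mulrDl.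
- exact: RL_integrand_integrable fA.
- exact: RL_integrand_integrable gB.
Qed.

Section hoelder_derivative.
Context (R : realType) (q b C a x0 : R) (g : R -> R).
Hypotheses (q0 : 0 < q) (qb : q < b) (b1 : b < 1) (ax0 : a < x0).
Hypothesis mg : measurable_fun setT g.
Hypothesis hg : forall u, `|g u - g x0| <= C * `|x0 - u| `^ b.

(** Leaves room to the right of [x0], so that one fixed domain serves small increments of either
    sign. *)
Let c := x0 + 1.
Let gt u := g u - g x0.
(** The candidate derivative, obtained by formal differentiation under the integral sign.
    Subtracting [g x0] is what makes it converge: the gain |x0 - u|^b turns the exponent -q - 1 into
    b - q - 1 > -1. *)
Let D1 := \int[@lebesgue_measure R]_(u in `[a, c])
  (gt u * RL_kernel_der q (x0 - u)).

Let C0 : 0 <= C.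
Proof.
have := hg (x0 + 1); rewrite opprD addrA subrr sub0r normrN normr1 powR1 mulr1.
exact: le_trans.
Qed.

Let mgt : measurable_fun setT gt.
Proof. exact: measurable_funB. Qed.

Let der_dom u : `|gt u * RL_kernel_der q (x0 - u)| <=
  C * q * `|x0 - u| `^ (b - q - 1).
Proof.
rewrite normrM /RL_kernel_der.
have [xu|xu] := ltP 0 (x0 - u); last first.
  by rewrite normr0 mulr0 !mulr_ge0// ?powR_ge0// ltW.
rewrite normrM normrN (gtr0_norm q0) (@ger0_norm _ (_ `^ _)) ?powR_ge0//.
have -> : b - q - 1 = b + (- q - 1) by ring.
rewrite powRD; last by rewrite normr_eq0 (gt_eqF xu) implybT.
rewrite [X in _ <= _ * (_ * X `^ _)]gtr0_norm//.
have := ler_wpM2r (mulr_ge0 (ltW q0) (powR_ge0 (x0 - u) (- q - 1))) (hg u).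
by move=> h; apply: (le_trans h); rewrite le_eqVlt; apply/predU1P; left; ring.
Qed.

Let mder : measurable_fun setT (fun u => gt u * RL_kernel_der q (x0 - u)).
Proof. by apply: measurable_funM => //; exact: measurable_RL_kernel_der. Qed.

Let bq0 : 0 < b - q. Proof. by rewrite subr_gt0. Qed.

Let der_int c' : (@lebesgue_measure R).-integrable `[a, c']
  (EFin \o fun u => gt u * RL_kernel_der q (x0 - u)).
Proof.
apply: (@integrable_dominated _ _ _ (fun u => C * q * `|x0 - u| `^ (b - q - 1))) => //.
- exact: measurable_funTS.
- by apply: integrableZl_EFin => //; exact: weak_kernel_integrable.
Qed.

Let D1_le : `|D1| <= C * q * ((x0 - a) `^ (b - q) / (b - q)).
Proof.
have x0c : x0 <= c by rewrite lerDl.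
rewrite /D1 (Rintegral_itv_cat (ltW ax0) x0c (der_int _)).
rewrite [X in _ + X]Rintegral_eq0 ?addr0; last first.
  move=> u; rewrite inE/= in_itv/= => /andP[xu _].
  by rewrite /RL_kernel_der subr_gt0 ltNge xu/= mulr0.
rewrite -(weak_kernel_left bq0 (ltW ax0)).2 -RintegralZl//; last first.
  exact: weak_kernel_integrable.
apply: le_norm_Rintegral_dominated => //.
- exact: measurable_funTS.
- by apply: integrableZl_EFin => //; exact: weak_kernel_integrable.
Qed.

Let gt_bound u : u \in `[a, c] -> `|gt u| <= C * (c - a) `^ b.
Proof.
rewrite in_itv/= => /andP[au uc]; apply: (le_trans (hg u)).
apply: ler_wpM2l => //; apply: norm_powR_le => //; first by rewrite ltW // (lt_trans q0).
by rewrite ler_norml; have := ax0; move: uc; rewrite /c => uc ?; apply/andP; split; lra.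
Qed.

Let q01 : 0 < q < 1. Proof. by rewrite q0 (lt_trans qb). Qed.

(** It has to satisfy 0 < e, so that the remainder is o(h), and e < b - q, so that the dominating
    function is integrable. *)
Let e := (b - q) / 2.

(** Over the common domain the difference becomes one integral, to which [RL_kernel_taylor] applies
    pointwise with k = x0 - u, the Hoelder bound providing the weight |k|^b. The factor 4 collects 2
    from each of the singularities x0 and x0 + h. *)
Let gt_remainder h : a <= x0 + h <= c ->
  `|RL_integral q a gt (x0 + h) - RL_integral q a gt x0 - h * D1| <=
  C * 2 * (4 * ((c - a) `^ (b - q - e) / (b - q - e))) * `|h| `^ (1 + e).
Proof.
move=> /andP[axh xhc].
have x0c : x0 <= c by rewrite lerDl.
have ac : a <= c by rewrite (le_trans (ltW ax0)).
have e0 : 0 < e by rewrite divr_gt0.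
have e1 : e < 1 by have := (q0, qb, b1); rewrite /e; case=> -[]; lra.
have g0 : 0 < b - q - e by have := (q0, qb, b1); rewrite /e; case=> -[]; lra.
have [I1 ->] := RL_integral_kernelE q01 axh xhc mgt gt_bound.
have [I0 ->] := RL_integral_kernelE q01 (ltW ax0) x0c mgt gt_bound.
rewrite -RintegralB// -[X in _ - X]RintegralZl// -RintegralB//; last 2 first.
- by have := integrableB _ I1 I0; apply; exact: measurable_itv.
- exact: integrableZl_EFin.
pose dom u := C * 2 * `|h| `^ (1 + e) *
  (`|x0 - u| `^ (b - q - e - 1) + `|x0 + h - u| `^ (b - q - e - 1)).
have Iw z : (@lebesgue_measure R).-integrable `[a, c]
    (EFin \o fun u => `|z - u| `^ (b - q - e - 1)).
  exact: weak_kernel_integrable.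
have Iw2 : (@lebesgue_measure R).-integrable `[a, c]
    (EFin \o fun u => `|x0 - u| `^ (b - q - e - 1) +
      `|x0 + h - u| `^ (b - q - e - 1)).
  by have := integrableD _ (Iw x0) (Iw (x0 + h)); apply; exact: measurable_itv.
apply: (@le_trans _ _ (\int[@lebesgue_measure R]_(u in `[a, c]) dom u)).
  apply: le_norm_Rintegral_dominated => //.
  - apply: measurable_funTS; apply: measurable_funB.
      by apply: measurable_funB; apply: measurable_funM => //;
        exact: measurable_RL_kernel.
    exact: measurable_funM.
  - move=> u _.
    have -> : x0 + h - u = x0 - u + h by ring.
    rewrite mulrCA -!mulrBr normrM.
    apply: (le_trans (ler_wpM2r (normr_ge0 _) (hg u))).
    rewrite /dom (_ : x0 + h - u = x0 - u + h); last by ring.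
    rewrite -!mulrA ler_wpM2l// [leRHS]mulrA.
    apply: RL_kernel_taylor => //; apply/andP; split => //.
    exact: lt_trans qb.
  - exact: integrableZl_EFin.
rewrite /dom RintegralZl// [leRHS]mulrAC.
rewrite ler_wpM2l// ?mulr_ge0 ?powR_ge0// RintegralD//.
have B z : a <= z <= c -> \int[@lebesgue_measure R]_(u in `[a, c])
    (`|z - u| `^ (b - q - e - 1)) <= 2 * (c - a) `^ (b - q - e) / (b - q - e).
  exact: weak_kernel_integral_le.
have B0 := B x0; rewrite (ltW ax0) x0c in B0.
have B1 := B (x0 + h); rewrite axh xhc in B1.
apply: (le_trans (lerD (B0 isT) (B1 isT))).
by rewrite le_eqVlt; apply/predU1P; left; ring.
Qed.

(** [g] is split into [gt], whose integral has derivative [D1], and the constant [g x0], whose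
    integral is explicit. The derivative of the latter is kept apart because it becomes small only
    if g also vanishes at a. *)
Lemma RL_integral_hoelder_derive : exists D, is_derive x0 (1 : R) (RL_integral q a g) D /\
  `|D - g x0 * (x0 - a) `^ (- q)| <= C * q * ((x0 - a) `^ (b - q) / (b - q)).
Proof.
exists (D1 + g x0 * (x0 - a) `^ (- q)); split; last by rewrite addrK.
have ax := ax0.
have [_ q1] := andP q01.
have d1 : is_derive x0 (1 : R) (RL_integral q a gt) D1.
  apply: (@is_derive_remainder _ _ _ _ _ e _ _); first by rewrite divr_gt0.
  have nb : \forall h \near (0 : R), `|h| < Num.min 1 (x0 - a).
    by apply: nbhs0_lt; rewrite lt_min ltr01 subr_gt0.
  move: nb; apply: filterS => h; rewrite lt_min !ltr_norml.
  move=> /andP[/andP[h1 h2] /andP[h3 h4]]; apply: gt_remainder.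
  by rewrite /c; apply/andP; split; lra.
have d2 : is_derive x0 (1 : R) (fun x => g x0 * ((x - a) `^ (1 - q) / (1 - q)))
    (g x0 * (x0 - a) `^ (- q)).
  have xa0 : 0 < x0 - a by rewrite subr_gt0.
  have H := is_derive1_powR (1 - q) xa0.
  have H2 : is_derive x0 (1 : R) (fun u => u - a) 1.
    by apply: is_derive_eq; ring.
  have H3 := @is_derive1_comp R (fun x => x `^ (1 - q)) (fun u => u - a) x0 _ _ H H2.
  have H4 := is_deriveZ (g x0 / (1 - q)) H3.
  have -> : (fun x => g x0 * ((x - a) `^ (1 - q) / (1 - q))) =
      (g x0 / (1 - q)) \*: ((fun x => x `^ (1 - q)) \o (fun u => u - a)).
    by apply/funext => x /=; rewrite /GRing.scale/=; ring.
  apply: (is_derive_eq H4); rewrite mulr1 /GRing.scale/=.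
  have -> : 1 - q - 1 = - q by ring.
  by field; rewrite subr_eq0 gt_eqF.
have d3 := is_deriveD d1 d2.
apply: near_eq_is_derive d3.
near=> x.
have xa : a <= x by apply: ltW; near: x; exact: lt_nbhsr.
have xc : x <= c by apply: ltW; near: x; apply: lt_nbhsl; rewrite ltrDl.
rewrite -[LHS]/(RL_integral q a gt x + g x0 * ((x - a) `^ (1 - q) / (1 - q))).
rewrite -(RL_integral_cst _ q1 xa) -(@RL_integralD _ q a x (C * (c - a) `^ b) `|g x0|)//.
- by congr (RL_integral q a _ x); apply/funext => u; rewrite /gt subrK.
- by move=> u; rewrite in_itv/= => /andP[au ux]; apply: gt_bound;
    rewrite in_itv/= au (le_trans ux).
Unshelve. all: end_near. Qed.

End hoelder_derivative.

Lemma hoelder_continuous (R : realType) (f : R -> R) (b C : R) : 0 < b ->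
  (forall u v, `|f u - f v| <= C * `|u - v| `^ b) -> continuous f.
Proof.
move=> b0 hf x; apply/cvgrPdist_le => eps eps0.
have H : C * `|x - u| `^ b @[u --> x] --> C * 0.
  by apply: cvgMr; exact: powR_dist_cvg0.
rewrite mulr0 in H; move/cvgrPdist_le : H => /(_ _ eps0).
apply: filterS => u; rewrite sub0r normrN => h.
by apply: (le_trans (hf _ _)); apply: le_trans h; exact: ler_norm.
Qed.

Lemma hoelder_LFD_exists (R : realType) (f : R -> R) (y q b C : R) :
  0 < q -> q < b -> b < 1 ->
  (forall u v, `|f u - f v| <= C * `|u - v| `^ b) -> LFD_exists q f y.
Proof.
move=> q0 qb b1 hf; have b0 := lt_trans q0 qb; have q1 := lt_trans qb b1.
have bq0 : 0 < b - q by rewrite subr_gt0.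
have C0 : 0 <= C.
  have := hf 1 0; rewrite subr0 normr1 powR1 mulr1; exact: le_trans.
have mf : measurable_fun setT f.
  exact: continuous_measurable_fun (hoelder_continuous b0 hf).
pose g u := f u - f y.
have mg : measurable_fun setT g by exact: measurable_funB.
have der x : y < x -> exists D, is_derive x (1 : R) (RL_integral q y g) D /\
    `|D - g x * (x - y) `^ (- q)| <= C * q * ((x - y) `^ (b - q) / (b - q)).
  move=> yx; apply: RL_integral_hoelder_derive => // u.
  by rewrite /g opprB addrA subrK distrC; apply: (le_trans (hf _ _)).
exists 0; split.
  near=> x; have yx : y < x by near: x; exact: nbhs_right_gt.
  rewrite /RL_derivable lt_eqF//; split.
    near=> z; apply: (@RL_integrand_integrable _ _ _ _ _ (C * (z - y) `^ b)) => // u.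
    rewrite in_itv/= => /andP[yu uz]; apply: (le_trans (hf _ _)).
    rewrite ler_wpM2l//; apply: norm_powR_le => //; first exact: ltW.
    by rewrite ger0_norm ?subr_ge0// lerD2r.
  by have [D [dD _]] := der x yx; exact: ex_derive.
apply/cvgrPdist_le => eps eps0.
(* The first summand comes from the integral term, the second from the boundary term, where g y = 0
   yields |g x| <= C (x - y)^b. *)
pose K := `|(Gamma (1 - q))^-1| * (C * q / (b - q) + C).
have H : K * `|y - x| `^ (b - q) @[x --> y] --> K * 0.
  by apply: cvgMr; exact: powR_dist_cvg0.
rewrite mulr0 in H.
have {}H := cvg_at_right_filter H.
move/cvgrPdist_le : H => /(_ _ eps0) H.
near=> x.
have yx : y < x by near: x; exact: nbhs_right_gt.
have xy0 : 0 < x - y by rewrite subr_gt0.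
have Hx : `|0 - K * `|y - x| `^ (b - q)| <= eps by near: x.
apply: le_trans Hx; rewrite !sub0r !normrN.
apply: le_trans (ler_norm _).
rewrite /RL_derive lt_eqF// normrM /K -mulrA ler_wpM2l//.
have [D [dD Dle]] := der x yx.
rewrite derive1E (@derive_val _ _ _ _ _ _ _ dD).
rewrite -(subrK (g x * (x - y) `^ (- q)) D).
apply: (le_trans (ler_normD _ _)); rewrite [leRHS]mulrDl; apply: lerD.
  apply: (le_trans Dle); rewrite distrC (gtr0_norm xy0).
  by rewrite le_eqVlt; apply/predU1P; left; ring.
rewrite normrM (@ger0_norm _ (_ `^ _)) ?powR_ge0//.
rewrite (distrC y x) (gtr0_norm xy0) powRD ?(gt_eqF xy0) ?implybT// mulrA.
rewrite ler_wpM2r ?powR_ge0//.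
by have := hf x y; rewrite (gtr0_norm xy0).
Unshelve. all: end_near. Qed.

(** * Lacunary sine series *)

(** Index k carries the frequency lambda^(k+1), so that a series starting at 0 matches the sum
    starting at 1 in [weierstrass]. There r is lambda^(s-2). *)
Definition lacunary_term (R : realType) (r lambda t : R) (k : nat) : R :=
  r ^+ k.+1 * sin (lambda ^+ k.+1 * t).

Lemma weierstrassE (R : realType) (s lambda t : R) : 1 < lambda ->
  weierstrass s lambda t =
  limn (series (lacunary_term (lambda `^ (s - 2)) lambda t)).
Proof.
move=> l1; rewrite /weierstrass; congr (lim (_ @ \oo)).
apply/funext => n; rewrite /series/= big_add1/=.
apply: eq_bigr => k _; rewrite /lacunary_term.
by rewrite powRrM powR_mulrn// powR_ge0.
Qed.

Lemma is_cvg_lacunary (R : realType) (r lambda t : R) : 0 < r < 1 ->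
  cvgn (series (lacunary_term r lambda t)).
Proof.
move=> /andP[r0 r1]; apply: normed_cvg.
apply: (@series_le_cvg _ _ (geometric r r)) => [n|n|n|].
- by rewrite /=.
- by rewrite /= mulr_ge0 ?exprn_ge0// ltW.
- rewrite /= /lacunary_term normrM ger0_norm ?exprn_ge0 ?(ltW r0)//.
  by rewrite -exprS ler_piMr ?sin_max// exprn_ge0// ltW.
- by apply: is_cvg_geometric_series; rewrite ger0_norm// ltW.
Qed.

Lemma sin_lipschitz (R : realType) (x y : R) : `|sin x - sin y| <= `|x - y|.
Proof.
wlog xy : x y / x <= y.
  move=> H; have [|/ltW] := leP x y; first exact: H.
  by rewrite distrC (distrC x); exact: H.
rewrite distrC (distrC x).
have [|z _ ->] := @MVT_segment R sin cos x y xy.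
  by apply: continuous_subspaceT => z; exact: continuous_sin.
by rewrite normrM ler_piMl// cos_max.
Qed.

(** Interpolates between the Lipschitz bound, used for |x - y| <= 1, and the trivial bound 2, used
    beyond. *)
Lemma sin_hoelder (R : realType) (b x y : R) : 0 <= b <= 1 ->
  `|sin x - sin y| <= 2 * `|x - y| `^ b.
Proof.
move=> /andP[b0 b1]; have P := powR_ge0 `|x - y| b.
have [xy|xy] := leP `|x - y| 1.
  apply: (le_trans (sin_lipschitz x y)).
  have [->|xy0] := eqVneq `|x - y| 0; first by rewrite mulr_ge0// powR_ge0.
  apply: (@le_trans _ _ (`|x - y| `^ b)); last by lra.
  by apply: ger1_powR => //; rewrite lt_neqAle eq_sym xy0 normr_ge0 xy.
apply: (@le_trans _ _ 2).
  by apply: (le_trans (ler_normB _ _)); have := sin_max x; have := sin_max y; lra.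
rewrite ler_peMr// -[leLHS](powRr0 `|x - y|); apply: ler_powR => //.
exact: ltW.
Qed.

(** The Hoelder bounds of the single terms form a geometric series of ratio r lambda^b. The case b =
    0 is included on purpose: it gives boundedness. *)
Lemma lacunary_hoelder (R : realType) (r lambda b : R) : 0 < r < 1 ->
  0 < lambda -> 0 <= b <= 1 -> r * lambda `^ b < 1 ->
  exists C, forall u v, `|limn (series (lacunary_term r lambda u)) -
    limn (series (lacunary_term r lambda v))| <= C * `|u - v| `^ b.
Proof.
move=> r01 l0 b01 rho1; have [r0 r1] := andP r01.
set rho := r * _ in rho1.
have rho0 : 0 < rho by rewrite mulr_gt0// powR_gt0.
have nrho : `|rho| < 1 by rewrite gtr0_norm.
exists (2 * limn (series (geometric rho rho))) => u v.
rewrite -limB; [|exact: is_cvg_lacunary..].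
have cg := @is_cvg_geometric_series R rho rho nrho.
have cl : cvgn (series (lacunary_term r lambda u) - series (lacunary_term r lambda v)).
  by apply: is_cvgB; exact: is_cvg_lacunary.
rewrite (_ : 2 * _ * _ = (2 * `|u - v| `^ b) * limn (series (geometric rho rho))); last by ring.
have := @cvgMr _ _ _ _ _ (2 * `|u - v| `^ b) _ cg.
move=> cg2; apply: (ler_cvg_to (cvg_norm (FF := _) cl) (cg2 _)).
near=> n; rewrite /= fctE /series/= -sumrB.
apply: (le_trans (ler_norm_sum _ _ _)); rewrite mulr_sumr ler_sum// => k _.
rewrite /lacunary_term -mulrBr normrM ger0_norm ?exprn_ge0 ?(ltW r0)//.
have H := sin_hoelder (lambda ^+ k.+1 * u) (lambda ^+ k.+1 * v) b01.
apply: (le_trans (ler_wpM2l _ H)); first by rewrite exprn_ge0// ltW.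
rewrite -mulrBr normrM ger0_norm ?exprn_ge0 ?(ltW l0)//.
rewrite powRM ?exprn_ge0 ?(ltW l0)// -exprS /rho exprMn.
rewrite -(powR_mulrn k.+1 (ltW l0)) powRAC powR_mulrn ?powR_ge0//.
by rewrite le_eqVlt; apply/predU1P; left; ring.
Unshelve. all: end_near. Qed.

Lemma geometric_sum_lt (R : realFieldType) (B : R) (m : nat) : 1 < B ->
  \sum_(0 <= k < m) B ^+ k.+1 <= B ^+ m.+1 / (B - 1).
Proof.
move=> B1; have B10 : 0 < B - 1 by rewrite subr_gt0.
rewrite ler_pdivlMr//; elim: m => [|m IH].
  by rewrite big_nil mul0r exprn_ge0//; lra.
rewrite big_nat_recr//= mulrDl.
have -> : B ^+ m.+2 = B ^+ m.+1 + B ^+ m.+1 * (B - 1) by rewrite exprSr; ring.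
by rewrite lerD2r.
Qed.

Lemma geometric_sum_gt (R : realFieldType) (r : R) (m n : nat) : 0 < r < 1 ->
  \sum_(m <= k < n) r ^+ k.+1 <= r ^+ m.+1 / (1 - r).
Proof.
move=> /andP[r0 r1]; have r10 : 0 < 1 - r by rewrite subr_gt0.
have [nm|mn] := leqP n m.
  by rewrite big_geq// divr_ge0 ?exprn_ge0 ?ltW.
rewrite ler_pdivlMr//.
suff -> : (\sum_(m <= k < n) r ^+ k.+1) * (1 - r) = r ^+ m.+1 - r ^+ n.+1.
  by rewrite gerBl exprn_ge0// ltW.
elim: n mn => [//|n IH]; rewrite ltnS leq_eqVlt => /predU1P[->|mn].
  by rewrite big_nat1 (exprSr r n.+1); ring.
rewrite big_nat_recr/=; last exact: ltnW.
by rewrite mulrDl IH// (exprSr r n.+1); ring.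
Qed.

(** Frequencies below the m-th term are controlled by the Lipschitz bound, and their sum is
    dominated by its top term because r lambda > 1. Frequencies above it are controlled by their
    amplitudes. Relative to r^(m+1), both errors are small once r lambda and 1/r are large. *)
Lemma lacunary_main_term (R : realType) (r lambda X : R) (m : nat) (u y : R) :
  0 < r < 1 -> 1 < r * lambda -> 0 <= X ->
  lambda ^+ m.+1 * `|u - y| <= X ->
  `|limn (series (lacunary_term r lambda u)) -
    limn (series (lacunary_term r lambda y)) -
    (lacunary_term r lambda u m - lacunary_term r lambda y m)| <=
  r ^+ m.+1 * (X / (r * lambda - 1) + 2 * (r / (1 - r))).
Proof.
move=> r01 B1 X0 uyX; have [r0 r1] := andP r01.
have l0 : 0 < lambda by rewrite -(pmulr_rgt0 _ r0) (lt_trans ltr01).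
rewrite -limB; [|exact: is_cvg_lacunary..].
pose d k := lacunary_term r lambda u k - lacunary_term r lambda y k.
have cd : cvgn (series (lacunary_term r lambda u) - series (lacunary_term r lambda y)).
  by apply: is_cvgB; exact: is_cvg_lacunary.
pose S := series (lacunary_term r lambda u) - series (lacunary_term r lambda y).
have cd2 : `|S n - d m| @[n --> \oo] --> `|limn S - d m|.
  by apply: cvg_norm; apply: cvgB; [exact: cd | exact: cvg_cst].
rewrite -/(d m); apply: (cvgr_to_le cd2).
near=> N; rewrite /S fctE /series/= -sumrB.
have mN : (m < N)%N by near: N; exact: nbhs_infty_gt.
have -> : \sum_(0 <= i < N) (lacunary_term r lambda u i - lacunary_term r lambda y i)
   = \sum_(0 <= i < m) d i + (d m + \sum_(m.+1 <= i < N) d i).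
  rewrite (@big_cat_nat _ _ _ m)//=; last exact: ltnW.
  by congr (_ + _); rewrite big_ltn.
rewrite addrA addrAC addrK.
apply: (le_trans (ler_normD _ _)); rewrite mulrDr; apply: lerD.
  apply: (le_trans (ler_norm_sum _ _ _)).
  apply: (@le_trans _ _ (\sum_(0 <= k < m) (r * lambda) ^+ k.+1 * `|u - y|)).
    rewrite ler_sum// => k _; rewrite /d /lacunary_term -mulrBr normrM.
    rewrite ger0_norm ?exprn_ge0 ?(ltW r0)// exprMn -mulrA.
    rewrite ler_wpM2l ?exprn_ge0 ?(ltW r0)//.
    apply: (le_trans (sin_lipschitz _ _)).
    by rewrite -mulrBr normrM ger0_norm// exprn_ge0// ltW.
  rewrite -mulr_suml.
  apply: (le_trans (ler_wpM2r (normr_ge0 _) (geometric_sum_lt m B1))).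
  rewrite exprMn -!mulrA ler_wpM2l ?exprn_ge0 ?(ltW r0)//.
  rewrite mulrCA [leRHS]mulrC ler_wpM2l// invr_ge0 subr_ge0 ltW//.
apply: (le_trans (ler_norm_sum _ _ _)).
apply: (@le_trans _ _ (2 * \sum_(m.+1 <= k < N) r ^+ k.+1)).
  rewrite mulr_sumr ler_sum// => k _; rewrite /d /lacunary_term -mulrBr normrM.
  rewrite ger0_norm ?exprn_ge0 ?(ltW r0)// mulrC ler_wpM2r ?exprn_ge0 ?(ltW r0)//.
  apply: (le_trans (ler_normB _ _)).
  by have := sin_max (lambda ^+ k.+1 * u); have := sin_max (lambda ^+ k.+1 * y); lra.
rewrite mulrCA ler_wpM2l// mulrA -exprSr; exact: geometric_sum_gt.
Unshelve. all: end_near. Qed.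

(** * Linear growth forced by the existence of a local fractional derivative *)

(** Were [Gamma (1 - q)] equal to 0, its inverse would be 0 too and [RL_derive] would carry no
    information on the derivative of the integral. *)
Lemma Gamma_gt0 (R : realType) (z : R) : 0 < z < 1 -> 0 < Gamma z.
Proof.
move=> /andP[z0 z1]; rewrite /Gamma /Rintegral.
set f := fun u : R => u `^ (z - 1) * expR (- u).
have f0 u : 0 <= f u by rewrite mulr_ge0 ?powR_ge0 ?expR_ge0.
have mf : measurable_fun setT f.
  apply: measurable_funM => //.
  by apply: measurableT_comp => //; exact: measurable_funN.
have mfE (D : set R) : measurable_fun D (EFin \o f).
  by apply/measurable_EFinP; exact: measurable_funTS.
(* Finiteness is part of positivity: the real-valued integral sends an infinite value to 0. The
   integrand is dominated by u^(z-1) up to 1 and by exp(-u) beyond. *)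
have ltoo : (\int[@lebesgue_measure R]_(u in `]0%R, +oo[) (f u)%:E < +oo)%E.
  rewrite (@itv_bndbnd_setU _ _ _ (BRight 1)) ?bnd_simp//.
  rewrite ge0_integral_setU//=; last 3 first.
  - exact: mfE.
  - by move=> x _; rewrite lee_fin.
  - apply/disj_setPLR => x /=; rewrite !in_itv/= andbT => /andP[_ x1] xx.
    by move: xx; rewrite ltNge x1.
  apply: lte_add_pinfty.
    have /integrableP[mk fk] := @weak_kernel_integrable R z 0 1 0 z0.
    apply: le_lt_trans fk.
    apply: (@le_trans _ _ (\int[@lebesgue_measure R]_(u in `[0%R, 1%R]) (f u)%:E)%E).
      apply: ge0_subset_integral => //; first exact: mfE.
        by move=> x _; rewrite lee_fin.
      by move=> x /=; rewrite !in_itv/= => /andP[/ltW -> ->].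
    apply: ge0_le_integral => //.
    - by move=> x _; rewrite lee_fin.
    - exact: mfE.
    - exact: measurableT_comp.
    - move=> x /=; rewrite in_itv/= => /andP[x0 x1].
      rewrite lee_fin sub0r normrN (ger0_norm x0) (@ger0_norm _ (_ `^ _)) ?powR_ge0//.
      by rewrite ler_piMr ?powR_ge0// -expR0 ler_expR oppr_le0.
  have E : (\int[@lebesgue_measure R]_(x in `[1%R, +oo[) (expR (- x))%:E =
      0%:E - (- expR (- 1))%:E)%E.
    apply: (@ge0_continuous_FTC2y _ _ (fun x => - expR (- x))).
    - by move=> x _; exact: expR_ge0.
    - apply: continuous_subspaceT => x.
      apply: continuous_comp; first exact: continuousN.
      exact: continuous_expR.
    - rewrite -[X in _ --> X]oppr0; apply: cvgN; exact: cvgr_expR.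
    - by move=> x _; apply: ex_derive.
    - apply: cvg_at_right_filter; apply: cvgN.
      apply: (@continuous_comp _ _ _ -%R expR); first exact: continuousN.
      exact: continuous_expR.
    - move=> x _; rewrite derive1E derive_val; ring.
  apply: (@le_lt_trans _ _ (\int[@lebesgue_measure R]_(x in `[1%R, +oo[) (expR (- x))%:E)%E); last first.
    by rewrite E -EFinB ltry.
  apply: (@le_trans _ _ (\int[@lebesgue_measure R]_(x in `]1%R, +oo[) (expR (- x))%:E)%E).
    apply: ge0_le_integral => //.
    - by move=> x _; rewrite lee_fin.
    - exact: mfE.
    - apply/measurable_EFinP; apply: measurable_funTS.
      by apply: measurableT_comp => //; exact: measurable_funN.
    - move=> x /=; rewrite in_itv/= andbT => x1; rewrite lee_fin.
      rewrite ler_piMl ?expR_ge0//.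
      apply: (@le_trans _ _ (1 `^ (z - 1))); last by rewrite powR1.
      by apply: le0_powR_le => //; [lra|exact: ltW].
  apply: ge0_subset_integral => //.
  - apply/measurable_EFinP; apply: measurable_funTS.
    by apply: measurableT_comp => //; exact: measurable_funN.
  - by move=> x /=; rewrite !in_itv/= !andbT => /ltW.
apply: fine_gt0; rewrite ltoo andbT.
apply: (@lt_le_trans _ _ (\int[@lebesgue_measure R]_(u in `]0%R, 1%R]) (expR (- 1))%:E)%E).
  rewrite integral_cst//= lebesgue_measure_itv/= lte_fin ltr01 sube0 mule1.
  by rewrite lte_fin expR_gt0.
apply: (@le_trans _ _ (\int[@lebesgue_measure R]_(u in `]0%R, 1%R]) (f u)%:E)%E).
  apply: ge0_le_integral => //.
  - exact: mfE.
  - move=> x /=; rewrite in_itv/= => /andP[x0 x1]; rewrite lee_fin /f.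
    rewrite -[leLHS]mul1r ler_pM ?expR_ge0//.
      apply: (@le_trans _ _ (1 `^ (z - 1))); first by rewrite powR1.
      by apply: le0_powR_le => //; lra.
    by rewrite ler_expR lerN2.
apply: ge0_subset_integral => //.
- exact: mfE.
- by move=> x _; rewrite lee_fin.
- by move=> x /=; rewrite !in_itv/= andbT => /andP[].
Qed.

Lemma LFD_exists_linear_bound (R : realType) (f : R -> R) (y q B : R) :
  0 < q < 1 -> measurable_fun setT f -> (forall u, `|f u - f y| <= B) ->
  LFD_exists q f y ->
  exists M d, 0 < d /\ forall x, y < x -> x < y + d ->
    `|RL_integral q y (fun u => f u - f y) x| <= M * (x - y).
Proof.
move=> /andP[q0 q1] mf fB [l []].
set g := fun u => f u - f y; set I := RL_integral q y g.
move=> ndI cvI.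
have q10 : 0 < 1 - q < 1 by lra.
have G0 := Gamma_gt0 q10.
have mg : measurable_fun setT g by exact: measurable_funB.
have nearI : \forall x \near y^'+, derivable I x 1 /\
    `|derive1 I x| <= Gamma (1 - q) * (`|l| + 1).
  near=> x.
  have : RL_derivable q y g x by near: x.
  rewrite /RL_derivable lt_eqF// => -[_ dI]; split => //.
  have : `|RL_derive q y g x| <= `|l| + 1.
    near: x; move/cvgr_norm_le: cvI; apply; by rewrite ltrDl.
  rewrite /RL_derive lt_eqF// normrM gtr0_norm ?invr_gt0// ler_pdivrMl//.
have [d /= d0 Hd] := nearI.
exists (Gamma (1 - q) * (`|l| + 1)), d; split => // x yx xd.
set M := Gamma (1 - q) * _.
have P z : y < z -> z <= x -> derivable I z 1 /\ `|derive1 I z| <= M.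
  move=> yz zx; apply: Hd => //=.
  by rewrite ltr0_norm ?opprB ?subr_lt0//; lra.
have lip z : y < z -> z < x -> `|I x| <= M * (x - y) + `|I z|.
  move=> yz zx.
  have dI w : w \in `]z, x[ -> is_derive w (1 : R) I (derive1 I w).
    rewrite in_itv/= => /andP[zw wx]; rewrite derive1E; apply: derivableP.
    by apply: (P w _ _).1; [exact: lt_trans zw|exact: ltW].
  have cI : {within `[z, x], continuous I}.
    apply: continuous_subspace_itv => w; rewrite in_itv/= => /andP[zw wx].
    apply: differentiable_continuous; apply/derivable1_diffP.
    by apply: (P w _ _).1 => //; exact: lt_le_trans zw.
  have [c] := MVT zx dI cI; rewrite in_itv/= => /andP[zc cx] E.
  have [_ Mc] := P c (lt_trans yz zc) (ltW cx).
  have -> : I x = derive1 I c * (x - z) + I z by rewrite -E subrK.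
  apply: (le_trans (ler_normD _ _)); rewrite lerD2r normrM.
  have M0 := le_trans (normr_ge0 _) Mc.
  rewrite ler_pM// ger0_norm ?subr_ge0 ?(ltW zx)//.
  by rewrite lerD2l lerN2 ltW.
apply/ler_addgt0Pr => e e0.
have H : B / (1 - q) * `|y - z| `^ (1 - q) @[z --> y] --> B / (1 - q) * 0.
  by apply: cvgMr; apply: powR_dist_cvg0; rewrite subr_gt0.
rewrite mulr0 in H; have {}H := cvg_at_right_filter H.
move/cvgrPdist_le : H => /(_ _ e0) H.
near (y^'+) => z.
have yz : y < z by near: z; exact: nbhs_right_gt.
have zx : z < x by near: z; exact: nbhs_right_lt.
apply: (le_trans (lip z yz zx)); rewrite lerD2l.
have Hz : `|0 - B / (1 - q) * `|y - z| `^ (1 - q)| <= e by near: z.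
apply: le_trans Hz; rewrite sub0r normrN; apply: le_trans (ler_norm _).
have h := @RL_integral_le R q g y z B q1 (ltW yz) mg (fun u _ => fB u).
apply: (le_trans h); rewrite (distrC y z) (@gtr0_norm _ (z - y)) ?subr_gt0//.
by rewrite le_eqVlt; apply/predU1P; left; ring.
Unshelve. all: end_near. Qed.

(** * Lower bound at the scale of one frequency *)

(** The right endpoint is exempted because the Riemann-Liouville integrand is 0 there by convention,
    which would break lower bounds by its values. *)
Lemma le_Rintegral_co (R : realType) (f g : R -> R) (a b : R) :
  (@lebesgue_measure R).-integrable `[a, b] (EFin \o f) ->
  (@lebesgue_measure R).-integrable `[a, b] (EFin \o g) ->
  (forall u, a <= u -> u < b -> f u <= g u) ->
  \int[@lebesgue_measure R]_(u in `[a, b]) f u <=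
  \int[@lebesgue_measure R]_(u in `[a, b]) g u.
Proof.
move=> jf jg fg.
have sub : `[a, b[%classic `<=` `[a, b]%classic.
  by move=> u /=; rewrite !in_itv/= => /andP[-> /ltW ->].
have jf' : (@lebesgue_measure R).-integrable `[a, b[ (EFin \o f).
  exact: integrableS jf.
have jg' : (@lebesgue_measure R).-integrable `[a, b[ (EFin \o g).
  exact: integrableS jg.
rewrite -(Rintegral_itv_bndo_bndc jf') -(Rintegral_itv_bndo_bndc jg').
apply: le_Rintegral => // u /=; rewrite in_itv/= => /andP[]; exact: fg.
Qed.

Lemma continuous_itv_integrable (R : realType) (f : R -> R) (a b : R) :
  continuous f -> (@lebesgue_measure R).-integrable `[a, b] (EFin \o f).
Proof.
move=> cf; apply: continuous_compact_integrable; first exact: segment_compact.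
exact: continuous_subspaceT.
Qed.

Lemma Rintegral_continuous_FTC2 (R : realType) (F f : R -> R) (a b : R) :
  a < b -> continuous f -> (forall u : R, is_derive u (1 : R) F (f u)) ->
  \int[@lebesgue_measure R]_(u in `[a, b]) f u = F b - F a.
Proof.
move=> ab cf dF; rewrite /Rintegral.
have cF z : {for z, continuous F} by exact: is_derive1_continuous (dF z).
rewrite (continuous_FTC2 (F := F) ab)//.
- exact: continuous_subspaceT.
- split; first by move=> z _; have := dF z => ?; exact: ex_derive.
  + by apply: cvg_at_right_filter; exact: cF.
  + by apply: cvg_at_left_filter; exact: cF.
- by move=> z _; have := dF z => ?; rewrite derive1E derive_val.
Qed.

(** The kernel increases in u, so it is at least its value (x - a)^-q at the left end. *)
Lemma RL_integral_ge (R : realType) (q a x B : R) (F f : R -> R) :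
  0 < q < 1 -> a < x -> continuous f ->
  (forall u : R, is_derive u (1 : R) F (f u)) ->
  (forall u, `|f u| <= B) -> (forall u, a <= u -> u < x -> 0 <= f u) ->
  (x - a) `^ (- q) * (F x - F a) <= RL_integral q a f x.
Proof.
move=> /andP[q0 q1] ax cf dF fB f0.
have jf := @continuous_itv_integrable R f a x cf.
rewrite -(Rintegral_continuous_FTC2 ax cf dF) -RintegralZl//.
apply: le_Rintegral_co.
- exact: integrableZl_EFin.
- apply: (RL_integrand_integrable (B := B)) => //.
  exact: continuous_measurable_fun.
- move=> u au ux; rewrite /RL_integrand -powRN mulrC ler_wpM2l ?f0//.
  apply: le0_powR_le; [by rewrite oppr_le0 ltW|by rewrite subr_gt0|].
  by rewrite lerD2l lerN2.
Qed.

Section phase.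
Context (R : realType) (q N y : R).
Hypotheses (q01 : 0 < q < 1) (N0 : 0 < N).

Let sN u := sin (N * (u - y)).
Let cN u := 1 - cos (N * (u - y)).

Let csN : continuous sN.
Proof.
move=> u; apply: (@continuous_comp _ _ _ (fun u => N * (u - y)) sin).
  apply: continuousM; first exact: cst_continuous.
  by apply: continuousB; [exact: cvg_id|exact: cst_continuous].
exact: continuous_sin.
Qed.

Let ccN : continuous cN.
Proof.
move=> u; apply: continuousB; first exact: cst_continuous.
apply: (@continuous_comp _ _ _ (fun u => N * (u - y)) cos).
  apply: continuousM; first exact: cst_continuous.
  by apply: continuousB; [exact: cvg_id|exact: cst_continuous].
exact: continuous_cos.
Qed.

Let dsN (u : R) :
  is_derive u (1 : R) (fun u => - (N^-1 * cos (N * (u - y)))) (sN u).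
Proof.
apply: is_derive_eq; rewrite /sN /GRing.scale/=; field.
by rewrite gt_eqF.
Qed.

Let dcN (u : R) :
  is_derive u (1 : R) (fun u => u - N^-1 * sin (N * (u - y))) (cN u).
Proof.
apply: is_derive_eq; rewrite /cN /GRing.scale/=; field.
by rewrite gt_eqF.
Qed.

Let sN_le u : `|sN u| <= 2.
Proof. by apply: (le_trans (sin_max _)); lra. Qed.

Let cN_le u : `|cN u| <= 2.
Proof.
by rewrite ger0_norm /cN; have := cos_le1 (N * (u - y));
  have := cos_geN1 (N * (u - y)); lra.
Qed.

Let NX (X : R) : N * (y + X / N - y) = X.
Proof. by field; rewrite gt_eqF. Qed.

Let N00 : N * (y - y) = 0. Proof. by rewrite subrr mulr0. Qed.

Let yX (X : R) : y + X / N - y = X / N. Proof. by ring. Qed.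

Let powh (h : R) : 0 < h -> h `^ (- q) * h = h `^ (1 - q).
Proof.
move=> h0; rewrite addrC powRD ?(gt_eqF h0) ?implybT// powRr1//.
exact: ltW.
Qed.

(** The condition sin X = 0 makes the unweighted integral of the versine exactly X / N. *)
Lemma RL_integral_versine_ge (X : R) : 0 < X -> sin X = 0 ->
  (X / N) `^ (1 - q) <=
  RL_integral q y (fun u => 1 - cos (N * (u - y))) (y + X / N).
Proof.
move=> X0 sX; have h0 : 0 < X / N by rewrite divr_gt0.
have yx : y < y + X / N by rewrite ltrDl.
apply: le_trans (RL_integral_ge q01 yx ccN dcN cN_le _); last first.
  by move=> u _ _; rewrite subr_ge0 cos_le1.
by rewrite NX N00 sX sin0 !mulr0 !subr0 yX powh.
Qed.

Lemma RL_integral_versine_le (X : R) : 0 < X ->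
  RL_integral q y (fun u => 1 - cos (N * (u - y))) (y + X / N) <=
  2 / (1 - q) * (X / N) `^ (1 - q).
Proof.
move=> X0; have h0 : 0 < X / N by rewrite divr_gt0.
have [_ q1] := andP q01.
have yx : y <= y + X / N by rewrite lerDl ltW.
apply: (le_trans (ler_norm _)).
have mc := continuous_measurable_fun ccN.
apply: (le_trans (RL_integral_le q1 yx mc (fun u _ => cN_le u))).
by rewrite yX le_eqVlt; apply/predU1P; left; ring.
Qed.

(** The sine is nonnegative over this half period, with unweighted integral 2 / N, at least half of
    pi / N because pi <= 4. *)
Lemma RL_integral_sin_pi_ge :
  (pi / N) `^ (1 - q) / 2 <=
  RL_integral q y (fun u => sin (N * (u - y))) (y + pi / N).
Proof.
have p0 := @pi_gt0 R.
have h0 : 0 < pi / N by rewrite divr_gt0.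
have yx : y < y + pi / N by rewrite ltrDl.
apply: le_trans (RL_integral_ge q01 yx csN dsN sN_le _); last first.
  move=> u yu ux; apply: sin_ge0_pi; rewrite mulr_ge0 ?subr_ge0 ?(ltW N0)//=.
  by rewrite -(NX pi) ler_wpM2l ?(ltW N0)// lerD2r ltW.
rewrite NX N00 cospi cos0 yX -powh// -mulrA ler_wpM2l ?powR_ge0//.
have := @pihalf_lt2 R; rewrite ltr_pdivrMr// => p4.
rewrite -subr_ge0 (_ : _ - _ = (2 - pi / 2) / N); last by field; rewrite gt_eqF.
by rewrite divr_ge0 ?(ltW N0)//; lra.
Qed.

(* Weighting by an increasing kernel makes the negative half-wave dominate:
   compare the kernel with its value at the midpoint. *)
Lemma RL_integral_sin_2pi_le0 :
  RL_integral q y (fun u => sin (N * (u - y))) (y + (2 * pi) / N) <= 0.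
Proof.
have [q0 q1] := andP q01.
have p0 := @pi_gt0 R.
have h0 : 0 < pi / N by rewrite divr_gt0.
set x := y + _.
have xE : x = y + pi / N + pi / N by rewrite /x; ring.
have yx : y < x by rewrite ltrDl divr_gt0// mulr_gt0.
have -> : 0 = (pi / N) `^ (- q) * (- (N^-1 * cos (N * (x - y))) -
    - (N^-1 * cos (N * (y - y)))) :> R.
  by rewrite NX N00 mulr_natl cos2pi cos0 subrr mulr0.
rewrite -(Rintegral_continuous_FTC2 yx csN dsN).
have js := @continuous_itv_integrable R sN y x csN.
rewrite -RintegralZl//; apply: le_Rintegral_co.
- apply: (RL_integrand_integrable (B := 2)) => //.
    exact: continuous_measurable_fun.
  by move=> u _; exact: sN_le.
- exact: integrableZl_EFin.
move=> u yu ux; rewrite /RL_integrand -powRN [leRHS]mulrC -/(sN u).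
have NpE : N * (pi / N) = pi by field; rewrite gt_eqF.
have [um|um] := leP u (y + pi / N).
  have s0 : 0 <= sN u.
    apply: sin_ge0_pi; rewrite mulr_ge0 ?subr_ge0 ?(ltW N0)//=.
    by rewrite -[leRHS]NpE ler_wpM2l ?(ltW N0)//; lra.
  rewrite ler_wpM2l//; apply: le0_powR_le => //; first by rewrite oppr_le0 ltW.
  by rewrite xE; lra.
have s0 : sN u <= 0.
  have -> : sN u = - sin (N * (u - y) - pi).
    by rewrite sinB cospi sinpi /sN; ring.
  rewrite oppr_le0; apply: sin_ge0_pi; apply/andP; split.
    rewrite subr_ge0 -[leLHS]NpE ler_wpM2l ?(ltW N0)//; lra.
  have : N * (u - y) <= N * (pi / N + pi / N).
    by rewrite ler_wpM2l ?(ltW N0)//; move: ux; rewrite xE; lra.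
  have -> : N * (pi / N + pi / N) = pi + pi by rewrite mulrDr NpE.
  by lra.
rewrite ler_wnM2l//; apply: le0_powR_le; first by rewrite oppr_le0 ltW.
  by rewrite subr_gt0.
by rewrite xE; lra.
Qed.

End phase.

(** Here a and b are the sine and cosine of the phase, s and c the sine and versine integrals, at X
    = pi (index 1) and X = 2 pi (index 2). Changing both signs allows b >= 0. If a <= 0, the two
    parts add up at pi, with b + |a| >= a^2 + b^2 = 1. If a is at least eta, they add up at 2 pi. If
    0 < a < eta, then b is close to 1 and the sine part prevails at pi. *)
Lemma phase_dichotomy (R : realType) (a b s1 c1 s2 c2 P1 P2 K : R) :
  a ^+ 2 + b ^+ 2 = 1 -> 0 <= P1 -> 0 <= P2 -> 1 <= K ->
  P1 / 2 <= s1 -> P1 <= c1 -> c1 <= K * P1 -> s2 <= 0 -> P2 <= c2 ->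
  P1 / (2 + 4 * K) <= `|b * s1 - a * c1| \/
  P2 / (2 + 4 * K) <= `|b * s2 - a * c2|.
Proof.
wlog b0 : a b / 0 <= b.
  move=> H ab P10 P20 K1 h1 h2 h3 h4 h5; have [b0|b0] := leP 0 b; first exact: H.
  have := H (- a) (- b); rewrite !mulNr !sqrrN -!opprD !normrN; apply => //.
  by rewrite oppr_ge0 ltW.
move=> ab P10 P20 K1 h1 h2 h3 h4 h5.
have K0 : 0 < 2 + 4 * K by lra.
(* Chosen so that (1 - eta) / 2 - eta K = 1/4, the margin left in the case 0 < a < eta. *)
pose eta := (2 + 4 * K)^-1.
have eta0 : 0 < eta by rewrite invr_gt0.
have etaE : eta * (2 + 4 * K) = 1 by rewrite mulVf// gt_eqF.
rewrite -/eta.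
have eK : eta <= eta * K by rewrite ler_peMr// ltW.
have b1 : b <= 1.
  have := sqr_ge0 a; rewrite -[b <= 1](@ler_sqr _ b 1) ?nnegrE// expr1n; lra.
have bb : b ^+ 2 <= b by rewrite expr2 ler_piMl.
have [a0|a0] := leP a 0.
  left; apply: (@le_trans _ _ (P1 / 2)).
    by rewrite ler_wpM2l// -/eta; lra.
  apply: le_trans (ler_norm _).
  have aa : a ^+ 2 <= - a.
    have a1 : - a <= 1.
      rewrite -[- a <= 1](@ler_sqr _ (- a) 1) ?nnegrE// ?oppr_ge0//.
      by rewrite sqrrN expr1n; have := sqr_ge0 b; lra.
    by rewrite -sqrrN expr2 ler_piMl// oppr_ge0.
  have H1 : b * (P1 / 2) <= b * s1 by rewrite ler_wpM2l.
  have H2 : - a * (P1 / 2) <= - a * c1.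
    by rewrite ler_wpM2l ?oppr_ge0//; lra.
  have H3 : 1 * (P1 / 2) <= (b - a) * (P1 / 2).
    by rewrite ler_wpM2r//; lra.
  by move: H3; rewrite mulrBl; move: H2; rewrite !mulNr; lra.
have [ae|ae] := leP eta a.
  right; rewrite -normrN; apply: le_trans (ler_norm _).
  have H1 : b * s2 <= 0 by rewrite mulr_ge0_le0.
  have H2 : eta * P2 <= a * c2.
    by rewrite ler_pM// ltW.
  by rewrite mulrC; lra.
left; apply: le_trans (ler_norm _).
have a1 : a <= 1.
  have := sqr_ge0 b; rewrite -[a <= 1](@ler_sqr _ a 1) ?nnegrE ?(ltW a0)// expr1n; lra.
have aa : a ^+ 2 <= a by rewrite expr2 ler_piMl// ltW.
have H1 : (1 - eta) * (P1 / 2) <= b * s1.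
  apply: (@le_trans _ _ (b * (P1 / 2))); last by rewrite ler_wpM2l.
  by rewrite ler_wpM2r//; lra.
have H2 : a * c1 <= eta * (K * P1).
  have c10 : 0 <= c1 by lra.
  by rewrite ler_pM// ltW.
have -> : P1 * eta = (P1 / 4) * (4 * eta) by field.
have H3 : (1 - eta) * (P1 / 2) - eta * (K * P1) = P1 / 4.
  have -> : (1 - eta) * (P1 / 2) - eta * (K * P1) =
    P1 / 2 - P1 / 4 * (eta * (2 + 4 * K)) by field.
  by rewrite etaE; field.
have H4 : P1 / 4 * (4 * eta) <= P1 / 4.
  by rewrite ler_piMr//; [rewrite divr_ge0|lra].
lra.
Qed.

Lemma RL_integralZ (R : realType) (q a x k B : R) (f : R -> R) : q < 1 ->
  measurable_fun setT f -> (forall u, u \in `[a, x] -> `|f u| <= B) ->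
  RL_integral q a (fun u => k * f u) x = k * RL_integral q a f x.
Proof.
move=> q1 mf fB; rewrite -RintegralZl//; last exact: RL_integrand_integrable fB.
by apply: eq_Rintegral => u _; rewrite /RL_integrand mulrA.
Qed.

(** The addition formula under the integral. It produces the shape b s - a c treated by
    [phase_dichotomy]. *)
Lemma RL_integral_sinB (R : realType) (q N y x : R) : q < 1 ->
  RL_integral q y (fun u => sin (N * u) - sin (N * y)) x =
  cos (N * y) * RL_integral q y (fun u => sin (N * (u - y))) x -
  sin (N * y) * RL_integral q y (fun u => 1 - cos (N * (u - y))) x.
Proof.
move=> q1.
have mlin : measurable_fun setT (fun u : R => N * (u - y)).
  by apply: measurable_funM => //; exact: measurable_funB.
have ms : measurable_fun setT (fun u : R => sin (N * (u - y))).
  by apply: (measurableT_comp _ mlin); apply: continuous_measurable_fun; exact: continuous_sin.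
have mc : measurable_fun setT (fun u : R => 1 - cos (N * (u - y))).
  apply: measurable_funB => //.
  by apply: (measurableT_comp _ mlin); apply: continuous_measurable_fun; exact: continuous_cos.
have bs u : u \in `[y, x] -> `|sin (N * (u - y))| <= 1 by rewrite sin_max.
have bc u : u \in `[y, x] -> `|1 - cos (N * (u - y))| <= 2.
  move=> _; have := cos_le1 (N * (u - y)); have := cos_geN1 (N * (u - y)).
  by rewrite ler_norml => *; apply/andP; split; lra.
rewrite -(RL_integralZ _ q1 ms bs) -mulNr -(RL_integralZ _ q1 mc bc).
rewrite -(@RL_integralD _ q y x (`|cos (N * y)| * 1) (`|- sin (N * y)| * 2))//.
- congr (RL_integral q y _ x); apply/funext => u.
  rewrite (_ : N * u = N * (u - y) + N * y); last by ring.
  by rewrite sinD; ring.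
- exact: measurable_funM.
- exact: measurable_funM.
- by move=> u /bs h; rewrite normrM ler_wpM2l.
- by move=> u /bc h; rewrite normrM ler_wpM2l.
Qed.

Lemma powR_split1 (R : realType) (q h : R) : 0 < h -> h = h `^ (1 - q) * h `^ q.
Proof.
move=> h0; rewrite -powRD ?(gt_eqF h0) ?implybT//.
by rewrite subrK powRr1// ltW.
Qed.

(* The error E made by keeping the single frequency lambda^(m+1) of W is small
   against the lower bound eta of phase_dichotomy; K bounds 2 / (1 - q)
   uniformly for q near the critical order. *)
Section lacunary_lower_bound.
Context (R : realType) (r lambda q y K : R).
Hypotheses (r01 : 0 < r < 1) (rl1 : 1 < r * lambda) (q01 : 0 < q < 1).
Hypotheses (K1 : 1 <= K) (qK : 2 / (1 - q) <= K).
Let W u := limn (series (lacunary_term r lambda u)).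
Hypothesis mW : measurable_fun setT W.
Let E := 2 * pi / (r * lambda - 1) + 2 * (r / (1 - r)).
Let eta := (2 + 4 * K)^-1.
Hypothesis EK : E <= eta / K.

Lemma lacunary_RL_integral_ge (m : nat) (X : R) :
  0 < X -> X <= 2 * pi ->
  let N := lambda ^+ m.+1 in
  let P := (X / N) `^ (1 - q) in
  P * eta <= `|RL_integral q y (fun u => sin (N * u) - sin (N * y)) (y + X / N)| ->
  r ^+ m.+1 * (P * eta / 2) <=
    `|RL_integral q y (fun u => W u - W y) (y + X / N)|.
Proof.
move=> X0 X2pi N P PJ; have [r0 r1] := andP r01; have [q0 q1] := andP q01.
have l0 : 0 < lambda by rewrite -(pmulr_rgt0 _ r0) (lt_trans ltr01).
have N0 : 0 < N by rewrite exprn_gt0.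
have h0 : 0 < X / N by rewrite divr_gt0.
set x := y + X / N in PJ *.
have yx : y < x by rewrite ltrDl.
have rm0 : 0 < r ^+ m.+1 by rewrite exprn_gt0.
pose phi u := sin (N * u) - sin (N * y).
pose rest u := W u - W y - r ^+ m.+1 * phi u.
have mphi : measurable_fun setT phi.
  apply: measurable_funB => //.
  apply: (@measurableT_comp _ _ _ _ _ _ sin); last exact: measurable_funM.
  by apply: continuous_measurable_fun; exact: continuous_sin.
have mWy : measurable_fun setT (fun u => W u - W y) by exact: measurable_funB.
have mrest : measurable_fun setT rest.
  by apply: measurable_funB => //; exact: measurable_funM.
have phiB u : u \in `[y, x] -> `|phi u| <= 2.
  move=> _; apply: (le_trans (ler_normB _ _)).
  by have := sin_max (N * u); have := sin_max (N * y); lra.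
have restB u : u \in `[y, x] -> `|rest u| <= r ^+ m.+1 * E.
  rewrite in_itv/= => /andP[yu ux].
  rewrite /rest mulrBr; apply: lacunary_main_term => //.
    by rewrite mulr_ge0// pi_ge0.
  apply: le_trans X2pi; rewrite ger0_norm ?subr_ge0//.
  have -> : X = N * (X / N) by field; rewrite gt_eqF.
  by rewrite ler_wpM2l ?(ltW N0)// lerBlDl.
have E1 : RL_integral q y (fun u => W u - W y) x =
    r ^+ m.+1 * RL_integral q y phi x + RL_integral q y rest x.
  rewrite -(RL_integralZ _ q1 mphi phiB).
  rewrite -(@RL_integralD _ q y x (r ^+ m.+1 * 2) (r ^+ m.+1 * E))//.
  - by congr (RL_integral q y _ x); apply/funext => u; rewrite /rest; ring.
  - exact: measurable_funM.
  - by move=> u /phiB h; rewrite normrM (gtr0_norm rm0) ler_wpM2l// ltW.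
have Rrest := RL_integral_le q1 (ltW yx) mrest restB.
have xy : x - y = X / N by rewrite /x; ring.
rewrite xy -/P in Rrest.
have P0 : 0 <= P by exact: powR_ge0.
have K0 : 0 < K by have := K1; lra.
(* [EK] and [qK] combine to E / (1 - q) <= (eta / K) (K / 2), so half of the main term survives. *)
have EP : E * (P / (1 - q)) <= P * eta / 2.
  have q10 : 0 < (1 - q)^-1 by rewrite invr_gt0 subr_gt0.
  have E2 : E / (1 - q) <= eta / 2.
    apply: (@le_trans _ _ (eta / K / (1 - q))); first by rewrite ler_wpM2r// ltW.
    have -> : eta / K / (1 - q) = eta / 2 * (2 / (1 - q) / K).
      by field; apply/andP; split; rewrite gt_eqF// subr_gt0.
    rewrite ler_piMr//; last by rewrite ler_pdivrMr// mul1r.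
    by rewrite divr_ge0// invr_ge0; have := K1; lra.
  have := ler_wpM2r P0 E2.
  by rewrite (_ : E / (1 - q) * P = E * (P / (1 - q))) 1?mulrC//; last ring;
    move=> h; apply: (le_trans h); rewrite le_eqVlt; apply/predU1P; left; ring.
rewrite E1.
have T1 : r ^+ m.+1 * (P * eta) <= `|r ^+ m.+1 * RL_integral q y phi x|.
  by rewrite normrM (gtr0_norm rm0) ler_wpM2l// ltW.
have T2 : `|RL_integral q y rest x| <= r ^+ m.+1 * (P * eta / 2).
  apply: (le_trans Rrest); rewrite -mulrA ler_wpM2l// ltW//.
have := lerB_normD (r ^+ m.+1 * RL_integral q y phi x) (RL_integral q y rest x).
apply: le_trans.
have : r ^+ m.+1 * (P * eta) = r ^+ m.+1 * (P * eta / 2) + r ^+ m.+1 * (P * eta / 2).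
  by field.
lra.
Qed.

(** Which of pi and 2 pi occurs depends on m through the phase. Only the bounds 1 and 8, valid for
    both, are needed later. *)
Lemma lacunary_RL_integral_scale (m : nat) : exists X,
  [/\ 1 <= X, X <= 8 & let N := lambda ^+ m.+1 in
  r ^+ m.+1 * ((X / N) `^ (1 - q) * eta / 2) <=
    `|RL_integral q y (fun u => W u - W y) (y + X / N)|].
Proof.
have [r0 r1] := andP r01; have [q0 q1] := andP q01.
have l0 : 0 < lambda by rewrite -(pmulr_rgt0 _ r0) (lt_trans ltr01).
have N0 : 0 < lambda ^+ m.+1 by rewrite exprn_gt0.
have p0 := @pi_gt0 R.
have p1 := @pi_ge2 R.
have := @pihalf_lt2 R; rewrite ltr_pdivrMr// => p4.
have pp0 : 0 < 2 * pi :> R by rewrite mulr_gt0.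
set N := lambda ^+ m.+1.
have D : (pi / N) `^ (1 - q) * eta <=
     `|RL_integral q y (fun u => sin (N * u) - sin (N * y)) (y + pi / N)| \/
   (2 * pi / N) `^ (1 - q) * eta <=
     `|RL_integral q y (fun u => sin (N * u) - sin (N * y)) (y + 2 * pi / N)|.
  rewrite !RL_integral_sinB//.
  apply: phase_dichotomy; rewrite ?powR_ge0//.
  - by rewrite addrC; exact: cos2Dsin2.
  - exact: RL_integral_sin_pi_ge.
  - by apply: RL_integral_versine_ge => //; exact: sinpi.
  - apply: (le_trans (RL_integral_versine_le y q01 N0 p0)).
    by rewrite ler_wpM2r ?powR_ge0.
  - exact: RL_integral_sin_2pi_le0.
  - by apply: RL_integral_versine_ge => //; rewrite mulr_natl; exact: sin2pi.
case: D => D; [exists pi|exists (2 * pi)]; split; try lra.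
- by apply: lacunary_RL_integral_ge => //; lra.
- exact: lacunary_RL_integral_ge.
Qed.

Hypothesis rlq : 1 < r * lambda `^ q.

Lemma lacunary_not_LFD_exists : ~ LFD_exists q W y.
Proof.
move=> HL; have [r0 r1] := andP r01; have [q0 q1] := andP q01.
have l0 : 0 < lambda by rewrite -(pmulr_rgt0 _ r0) (lt_trans ltr01).
(* The Hoelder estimate is then taken with exponent 0, which yields the boundedness of W - W(y). *)
have l1 : 1 < lambda.
  by apply: (lt_le_trans rl1); rewrite ler_piMl// ltW.
have r00 : r * lambda `^ 0 < 1 by rewrite powRr0 mulr1.
have b00 : 0 <= (0 : R) <= 1 by rewrite lexx ler01.
have [C HC] := lacunary_hoelder r01 l0 b00 r00.
have WB u : `|W u - W y| <= C by have := HC u y; rewrite powRr0 mulr1.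
have [M [d [d0 HM]]] := LFD_exists_linear_bound q01 mW WB HL.
have eta0 : 0 < eta by rewrite invr_gt0; have := K1; lra.
(* Dividing the two bounds at scale X / lambda^n by r^n (X / lambda^n)^(1-q) leaves eta / 2 <= 8 |M|
   tau^n, and tau < 1 is exactly the condition that q exceeds the critical order. *)
set tau := (r * lambda `^ q)^-1.
have tau0 : 0 < tau by rewrite invr_gt0 (lt_trans ltr01).
have tau1 : tau < 1 by rewrite invf_lt1// (lt_trans ltr01).
have cv1 : 8 * `|M| * tau ^+ n @[n --> \oo] --> 8 * `|M| * 0.
  by apply: cvgMr; apply: cvg_expr; rewrite gtr0_norm.
have cv2 : 8 * lambda^-1 ^+ n @[n --> \oo] --> (8 * 0 : R).
  apply: cvgMr; apply: cvg_expr; rewrite gtr0_norm ?invr_gt0//.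
  by rewrite invf_lt1.
rewrite mulr0 in cv1; rewrite mulr0 in cv2.
have e2 : 0 < eta / 2 by rewrite divr_gt0.
have n1 : \forall n \near \oo, 8 * `|M| * tau ^+ n < eta / 2 by exact: (cvgr_lt _ cv1).
have n2 : \forall n \near \oo, 8 * lambda^-1 ^+ n < d by exact: (cvgr_lt _ cv2).
have [n0 _ Hn] : \forall n \near \oo, 8 * `|M| * tau ^+ n < eta / 2 /\
    8 * lambda^-1 ^+ n < d by apply: filterS2 n1 n2 => n.
have [A1 A2] := Hn n0.+1 (leqnSn n0).
have [X [X1 X8 HX]] := lacunary_RL_integral_scale n0.
rewrite /= in HX; set N := lambda ^+ n0.+1 in HX.
have N0 : 0 < N by rewrite exprn_gt0.
have X0 : 0 < X by rewrite (lt_le_trans ltr01).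
have h0 : 0 < X / N by rewrite divr_gt0.
have hd : X / N < d.
  apply: le_lt_trans A2; rewrite exprVn -/N ler_wpM2r// invr_ge0 ltW//.
have B : r ^+ n0.+1 * ((X / N) `^ (1 - q) * eta / 2) <= `|M| * (X / N).
  apply: (le_trans HX); apply: (le_trans (HM _ _ _)); rewrite ?ltrDl ?ltrD2l//.
  rewrite (_ : y + X / N - y = X / N); last by ring.
  by rewrite ler_wpM2r ?(ltW h0)// ler_norm.
have P0 : 0 < (X / N) `^ (1 - q) by exact: powR_gt0.
have {}B : r ^+ n0.+1 * (eta / 2) <= `|M| * (X / N) `^ q.
  rewrite -(ler_pM2l P0).
  rewrite [leRHS]mulrCA -(powR_split1 q h0).
  by apply: le_trans B; rewrite le_eqVlt; apply/predU1P; left; ring.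
have hq : (X / N) `^ q <= 8 * (lambda `^ q)^-1 ^+ n0.+1.
  rewrite powRM ?invr_ge0 ?(ltW X0) ?(ltW N0)//.
  rewrite ler_pM ?powR_ge0//.
    by apply: le_trans X8; apply: ler1_powR => //; exact: ltW.
  rewrite -powR_inv1 ?(ltW N0)// powRAC -powR_inv1 ?powR_ge0//.
  rewrite powR_inv1 ?powR_ge0// powR_inv1 ?powR_ge0// exprVn.
  by rewrite /N -(powR_mulrn n0.+1 (ltW l0)) powRAC powR_mulrn ?powR_ge0.
have rn0 : 0 < r ^+ n0.+1 by rewrite exprn_gt0.
have : eta / 2 <= 8 * `|M| * tau ^+ n0.+1.
  rewrite -(ler_pM2l rn0) (le_trans B)//.
  apply: (le_trans (ler_wpM2l (normr_ge0 _) hq)).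
  rewrite /tau invfM exprMn !exprVn le_eqVlt; apply/predU1P; left.
  move: (r ^+ n0.+1) rn0 (_ `^ _ ^+ n0.+1)^-1 => z z0 v.
  by field; rewrite gt_eqF.
by rewrite leNgt A1.
Qed.

End lacunary_lower_bound.

(** * The threshold for lambda and the supremum *)

Theorem mainTheorem1 (R : realType) (s : R) (hs1 : 1 < s) (hs2 : s < 2) :
  exists L : R, forall lambda : R, 1 < lambda -> L <= lambda ->
    forall t : R, critical_order (weierstrass s lambda) t = 2 - s.
Proof.
have s10 : 0 < s - 1 by lra.
have s20 : 0 < 2 - s by lra.
(* For q <= (3 - s) / 2 one has 1 - q >= (s - 1) / 2, hence 2 / (1 - q) <= K. *)
pose K := 4 / (s - 1).
have K4 : 4 <= K by rewrite ler_pdivlMr//; lra.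
pose D := K * (2 + 4 * K).
have D0 : 0 < D by rewrite mulr_gt0; lra.
(* The error has to stay below 1 / D. With r lambda >= T and r T <= 1 its two parts are at most 8 /
   (10 D), as 2 pi <= 8, and 2 / (10 D). *)
pose T := 1 + 10 * D.
have T1 : 1 < T by rewrite /T; lra.
(* The sum exceeds each summand, which gives both lambda^(s-1) >= T, where lambda^(s-1) = r lambda,
   and lambda^(2-s) >= T, where lambda^(2-s) = 1 / r. *)
exists (T `^ (s - 1)^-1 + T `^ (2 - s)^-1) => lambda l1 Ll t.
have l0 : 0 < lambda by lra.
have Tle p : 0 < p -> T `^ p^-1 <= lambda -> T <= lambda `^ p.
  move=> p0 h; have -> : T = (T `^ p^-1) `^ p.
    by rewrite -powRrM mulVf ?gt_eqF// powRr1//; lra.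
  by apply: ge0_ler_powR; rewrite ?nnegrE ?powR_ge0 ?(ltW p0) ?(ltW l0).
have Tl1 : T <= lambda `^ (s - 1).
  by apply: Tle => //; have := powR_ge0 T (2 - s)^-1; lra.
have Tl2 : T <= lambda `^ (2 - s).
  by apply: Tle => //; have := powR_ge0 T (s - 1)^-1; lra.
pose r := lambda `^ (s - 2).
have powl p p' : lambda `^ p * lambda `^ p' = lambda `^ (p + p').
  by rewrite -powRD// (gt_eqF l0) implybT.
have pgt p : 0 < p -> 1 < lambda `^ p.
  by move=> p0; rewrite /powR gt_eqF// -expR0 ltr_expR mulr_gt0// ln_gt0.
have plt p : p < 0 -> lambda `^ p < 1.
  move=> p0; rewrite -(opprK p) powRN invf_lt1 ?powR_gt0//.
  by apply: pgt; rewrite oppr_gt0.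
have rV : r = (lambda `^ (2 - s))^-1 by rewrite -powRN opprB.
have r0 : 0 < r by exact: powR_gt0.
have rT : r * T <= 1.
  by rewrite rV ler_pdivrMl ?mulr1 ?powR_gt0.
have r1 : r < 1.
  by rewrite rV invf_lt1 ?powR_gt0// (lt_le_trans T1).
have r01 : 0 < r < 1 by rewrite r0 r1.
have rlE : r * lambda = lambda `^ (s - 1).
  by rewrite /r -[X in _ * X](powRr1 (ltW l0)) powl; congr (_ `^ _); ring.
have rl1 : 1 < r * lambda by rewrite rlE (lt_le_trans T1).
pose W u := limn (series (lacunary_term r lambda u)).
have WE : weierstrass s lambda = W by apply/funext => u; exact: weierstrassE.
have WH b : 0 < b -> b < 2 - s ->
    exists C, forall u v, `|W u - W v| <= C * `|u - v| `^ b.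
  move=> b0 bs; apply: lacunary_hoelder => //.
    by rewrite (ltW b0)/=; lra.
  by rewrite /r powl; apply: plt; lra.
have mW : measurable_fun setT W.
  have [||C HC] := WH ((2 - s) / 2); [lra|lra|].
  apply: continuous_measurable_fun; apply: (hoelder_continuous _ HC); lra.
have Eerr : 2 * pi / (r * lambda - 1) + 2 * (r / (1 - r)) <= (2 + 4 * K)^-1 / K.
  have -> : (2 + 4 * K)^-1 / K = 10 / (10 * D).
    by rewrite /D; field; apply/andP; split; lra.
  have p4 : pi <= 4 :> R.
    by have := @pihalf_lt2 R; rewrite ltr_pdivrMr//; lra.
  have D10 : 0 < 10 * D by lra.
  have e1 : 2 * pi / (r * lambda - 1) <= 8 / (10 * D).
    rewrite ler_pM ?mulr_ge0 ?pi_ge0 ?invr_ge0//; [lra|lra|].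
    by rewrite lef_pV2 ?posrE// ?rlE; move: Tl1; rewrite /T; lra.
  have e2 : 2 * (r / (1 - r)) <= 2 / (10 * D).
    rewrite ler_wpM2l// ler_pdivrMr ?subr_gt0// mulrC ler_pdivlMr//.
    by move: rT; rewrite /T; lra.
  apply: (le_trans (lerD e1 e2)); rewrite le_eqVlt; apply/predU1P; left.
  by field; lra.
rewrite WE /critical_order; set S := [set q | _].
have S2s : S (2 - s).
  split=> [|q' q'0 q's]; first by apply/andP; split; lra.
  pose b := (q' + (2 - s)) / 2.
  have [||C HC] := WH b; rewrite /b; [lra|lra|].
  by apply: (hoelder_LFD_exists t q'0 _ _ HC) => //; rewrite /b; lra.
have Sub q0 : S q0 -> q0 <= 2 - s.
  move=> [/andP[q00 q01] Hq]; rewrite leNgt; apply/negP => sq0.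
  (* The order to refute is not [q0] itself, which may be 1, but one strictly between 2 - s and
     [qm]: membership of [q0] in [S] provides the derivative there, and the bound K applies. *)
  pose qm := Num.min q0 ((3 - s) / 2).
  have qm1 : qm <= q0 by rewrite ge_min lexx.
  have qm2 : qm <= (3 - s) / 2 by rewrite ge_min lexx orbT.
  have qm0 : 2 - s < qm by rewrite lt_min sq0/=; lra.
  pose q := (2 - s + qm) / 2.
  have q0' : 0 < q by rewrite /q; lra.
  have qq0 : q < q0 by rewrite /q; lra.
  have qs : 2 - s < q by rewrite /q; lra.
  have q32 : q <= (3 - s) / 2 by rewrite /q; lra.
  apply: (@lacunary_not_LFD_exists _ r lambda q t K) => //.
  - by rewrite q0'/=; lra.
  - lra.
  - have q10 : 0 < 1 - q by lra.
    rewrite ler_pdivrMr// /K mulrAC ler_pdivlMr//; lra.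
  - by rewrite /r powl; apply: pgt; lra.
  - exact: Hq.
apply/eqP; rewrite eq_le; apply/andP; split.
  by apply: ge_sup => //; exists (2 - s).
by apply: ub_le_sup => //; exists (2 - s) => q /Sub.
Qed.
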